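(* Let $G$ be a finite simple graph, let $v$ be a new vertex not in $V(G)$, and let $G'=\mathrm{cone}(v,G)$ be the cone over $G$ with apex $v$. Then the following are equivalent: 1. $G'$ is Koszul; 2. $G'$ is closed; 3. $\mathrm{Ind}(G)$ is triangle-free and $G$ is chordal.
   Context: All graphs are finite, undirected and simple (no loops or multiple edges), and $k$ is a fixed field of characteristic zero. Cone: $\mathrm{cone}(v,G)$ is the graph with vertex set $V(G)\cup\{v\}$ and edge set $E(G)\cup\{\{u,v\} : u\in V(G)\}$. Binomial edge ideal: for a graph $H$ on the vertex set $[m]=\{1,\dots,m\}$, let $S=k[x_1,\dots,x_m,y_1,\dots,y_m]$ with its standard grading and $J_H=\langle f_{ij}=x_iy_j-x_jy_i : \{i,j\}\in E(H)\rangle\subset S$. Up to isomorphism, $S/J_H$ does not depend on how the vertices are labeled by $[m]$. Koszul: a standard graded $k$-algebra $A$ (with $A_0=k$) is Koszul if the residue field $k=A_0$ has a linear graded free resolution as an $A$-module. A graph $H$ is called Koszul if the algebra $S/J_H$ is Koszul. Closed: a graph $H$ on $m$ vertices is closed if its vertices can be labeled by $[m]$ so that for all edges $\{i,j\},\{r,l\}\in E(H)$ with $i<j$ and $r<l$ one has: $\{j,l\}\in E(H)$ if $i=r$ and $j\neq l$; and $\{i,r\}\in E(H)$ if $j=l$ and $i\neq r$. Chordal: a graph is chordal if it has no induced cycle of length greater than $3$. Independence complex: $\mathrm{Ind}(G)$ is the simplicial complex on $V(G)$ whose faces are the independent sets of $G$ (sets of pairwise non-adjacent vertices). It is triangle-free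 if it has no face $\{a,b,c\}$ with three distinct vertices, i.e. $G$ has no three pairwise non-adjacent vertices. *)

(* Defs.v *)
From HB Require Import structures.
From mathcomp Require Import all_boot all_order all_algebra.
From mathcomp Require Import ring_quotient boolp mpoly.

Set Implicit Arguments.
Unset Strict Implicit.
Unset Printing Implicit Defensive.

Import GRing.Theory.

Local Open Scope ring_scope.
Local Open Scope quotient_scope.

(* Throughout, a graph on the vertex set T is its adjacency relation
   e : rel T, assumed symmetric and irreflexive where it is used. *)

Section Graphs.

Variables (T : finType) (e : rel T).

(* The apex is None; the vertices of e are embedded by Some. *)
Definition cone : rel (option T) := fun a b =>
  match a, b with
  | Some x, Some y => e x y
  | None, None => false
  | _, _ => true
  end.

(* An induced cycle of length n is a map f from Z/n whose image carries
   exactly the edges {f i, f (i + 1)}. *)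
Definition chordal : Prop :=
  forall n : nat, (3 < n)%N ->
    ~ exists f : 'I_n -> T,
        injective f /\
        forall i j : 'I_n, e (f i) (f j) = (j == ordS i) || (i == ordS j).

Definition independence_complex : {set {set T}} :=
  [set A : {set T} | [forall x in A, forall y in A, (x != y) ==> ~~ e x y]].

Definition closed_graph : Prop :=
  exists lab : T -> 'I_#|T|, bijective lab /\
    forall i j r l : T,
      e i j -> e r l -> (lab i < lab j)%N -> (lab r < lab l)%N ->
      (i = r -> j <> l -> e j l) /\ (j = l -> i <> r -> e i r).

End Graphs.

Definition triangle_free (T : finType) (K : {set {set T}}) : Prop :=
  forall a b c : T, a != b -> a != c -> b != c -> [set a; b; c] \notin K.

Section Koszul.

(* gr d x means that x lies in the component A_d of a graded ring A. *)
Variables (A : comNzRingType) (gr : nat -> A -> Prop).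

Definition irrelevant_ideal (a : A) : Prop :=
  exists s : seq A,
    (forall x, x \in s -> exists d : nat, gr d.+1 x) /\ a = \sum_(x <- s) x.

(* A resolution of the residue field A / A_+ = A_0 by graded free modules
   of finite rank
     F_i = A(- gr_deg i 0) (+) ... (+) A(- gr_deg i (gr_rank i - 1)),
   whose elements are row vectors. A homogeneous map F_(i+1) -> F_i of degree
   0 is right multiplication by a matrix whose (p, q) entry has degree
   gr_deg (i+1) p - gr_deg i q, and a homogeneous map F_0 -> A_0 of degree 0
   sends the basis vectors of degree 0 to elements of A_0 and the other ones to
   0. A value in the residue field is 0 when it lies in A_+. *)
Record graded_free_resolution := GradedFreeResolution {
  gr_rank : nat -> nat;
  gr_deg : forall i : nat, 'I_(gr_rank i) -> nat;
  gr_diff : forall i : nat, 'M[A]_(gr_rank i.+1, gr_rank i);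
  gr_aug : 'cV[A]_(gr_rank 0);
  gr_diff_homog : forall (i : nat) (p : 'I_(gr_rank i.+1)) (q : 'I_(gr_rank i)),
    if (gr_deg q <= gr_deg p)%N then gr (gr_deg p - gr_deg q) (gr_diff i p q)
    else gr_diff i p q = 0;
  gr_aug_homog : forall q : 'I_(gr_rank 0),
    if gr_deg q == 0%N then gr 0 (gr_aug q 0) else gr_aug q 0 = 0;
  gr_aug_surj : exists u : 'rV[A]_(gr_rank 0),
    irrelevant_ideal ((u *m gr_aug) 0 0 - 1);
  gr_exact0 : forall u : 'rV[A]_(gr_rank 0),
    irrelevant_ideal ((u *m gr_aug) 0 0) <->
    exists w : 'rV[A]_(gr_rank 1), u = w *m gr_diff 0;
  gr_exactS : forall (i : nat) (u : 'rV[A]_(gr_rank i.+1)),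
    u *m gr_diff i = 0 <->
    exists w : 'rV[A]_(gr_rank i.+2), u = w *m gr_diff i.+1
}.

Definition linear_resolution (F : graded_free_resolution) : Prop :=
  forall (i : nat) (p : 'I_(gr_rank F i)), gr_deg p = i.

Definition koszul : Prop :=
  exists F : graded_free_resolution, linear_resolution F.

End Koszul.

Section BinomialEdgeIdeal.

Variables (k : fieldType) (m : nat) (h : rel 'I_m).

Notation S := {mpoly k[m + m]}.

Definition bei_x (i : 'I_m) : S := 'X_(lshift m i).
Definition bei_y (i : 'I_m) : S := 'X_(rshift m i).

Definition bei_gen (i j : 'I_m) : S := bei_x i * bei_y j - bei_x j * bei_y i.

(* Each edge contributes both f_ij and f_ji = - f_ij. *)
Definition binomial_edge_ideal : {pred S} := fun p =>
  `[< exists c : 'I_m -> 'I_m -> S,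
        p = \sum_(i < m) \sum_(j < m | h i j) c i j * bei_gen i j >].

Lemma binomial_edge_ideal_closed : idealr_closed binomial_edge_ideal.
Proof.
split.
- by apply/asboolP; exists (fun _ _ => 0); rewrite big1 // => i _;
    rewrite big1 // => j _; rewrite mul0r.
- apply/negP => /asboolP[c] /(congr1 (mpoly.meval (fun=> 0))).
  rewrite rmorph1 raddf_sum big1 => [/eqP|i _]; first by rewrite oner_eq0.
  rewrite raddf_sum big1 // => j _.
  by rewrite /= mevalM mevalB !mevalM !mevalXU !mulr0 subr0 mulr0.
- move=> a u v /asboolP[c ->] /asboolP[d ->]; apply/asboolP.
  exists (fun i j => a * c i j + d i j).
  rewrite mulr_sumr -big_split; apply: eq_bigr => i _ /=.
  rewrite mulr_sumr -big_split; apply: eq_bigr => j _ /=.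
  by rewrite mulrDl mulrA.
Qed.

HB.instance Definition _ :=
  isIdealr.Build S binomial_edge_ideal binomial_edge_ideal_closed.

Definition bei_quotient : comNzRingType := {ideal_quot binomial_edge_ideal}.

Definition bei_grading (d : nat) (a : bei_quotient) : Prop :=
  exists p : S, p \is d.-homog /\ a = \pi_{ideal_quot binomial_edge_ideal} p.

End BinomialEdgeIdeal.

(* The vertices are numbered by enum_val; the choice of the numbering does not
   matter up to isomorphism. *)
Definition koszul_graph (k : fieldType) (T : finType) (e : rel T) : Prop :=
  koszul (@bei_grading k #|T| (fun i j => e (enum_val i) (enum_val j))).

(* Main.v *)
Require Import Defs.
From HB Require Import structures.
From mathcomp Require Import ring_quotient boolp mpoly.
From mathcomp Require Import all_boot all_algebra.
From mathcomp Require Import ring zify.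

Set Implicit Arguments.
Unset Strict Implicit.
Unset Printing Implicit Defensive.

Import GRing.Theory.

(** The third condition says that the complement of [G] has no triangle and that [G] has no
    induced cycle of length at least 4. Such a [G] is covered by two cliques [A] and
    [B]: the complement is bipartite ([two_cliques]). The absence of induced 4-cycles
    makes the neighbourhoods in [B] of the vertices of [A], and conversely, nested.
    Listing [A], the apex and [B] in the order given by these neighbourhoods yields an
    interval labelling of the cone: whenever [a < b < c] and [a], [c] are adjacent, [b]
    is adjacent to both ([cone_interval_labelling]). An interval labelling shows that
    the cone is closed, and conversely the third condition follows from closedness by looking at the
    labels of three independent vertices, respectively of the vertices of a cycle. So
    it remains to compare the third condition with Koszulness.

    An interval labelling makes the cone Koszul because of a Koszul filtration. Call a
    set of vertices closed upwards if it contains the vertices with larger labels than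
    its members. In [S / J] consider the ideals generated by the [x_a] with [a] in [X]
    and the [y_b] with [b] in [Y], where [Y] is contained in [X] and [X] is closed
    upwards. Removing generators one at a time, each colon ideal that appears is
    again of this form ([colon_y], [colon_x]); the essential point is that [x_a] is
    regular modulo the edges among the vertices up to [a] ([last_x_regular]), which is
    proved by induction without any Groebner basis. The family contains 0 and the
    maximal ideal. A matrix whose rows have linear entries and colon ideals in the
    family has a syzygy matrix of the same kind ([linear_quotients_syzygies]), so
    that a linear resolution of the residue field is obtained by iteration.

    Conversely, the Koszul property forbids induced claws, hence three independent
    vertices in [G], and induced cycles of length at least 4. In both cases the
    variables of the subgraph split into two groups, such that its edges are linear
    forms in the variables [u_i] of the first group with coefficients [phi e i] linear
    in the second group: the centre against the leaves for a claw, the [x]'s against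
    the [y]'s for a cycle. If [phi] has no syzygies in degree less than [d], where
    [d] is at least 2, but a nonzero one in degree [d], then the resolution of the
    residue field needs a generator of degree [d + 2] in homological degree 3. This is
    established by comparing an arbitrary linear resolution with the part of degree
    at most one in the [u_i] ([linear_part_obstruction]). For a claw with leaves 1, 2,
    3 the syzygy is [(f_23, - f_13, f_12)]; for a cycle it is the telescoping sum of
    the [x_i / y_i - x_j / y_j] along the cycle. *)

(** * Interval labellings of graphs *)

Lemma sorting_bijection (U : finType) (key : U -> nat) :
  exists lab : U -> 'I_#|U|, bijective lab /\
    forall a b, lab a < lab b -> key a <= key b.
Proof.
pose r := relpre key leq; pose s := sort r (enum U).
have mem_s x : x \in s by rewrite mem_sort mem_enum.
have size_s : size s = #|U| by rewrite size_sort cardE.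
have lt_s x : index x s < #|U| by rewrite -size_s index_mem.
pose lab x := Ordinal (lt_s x); exists lab; split.
  apply: inj_card_bij; last by rewrite card_ord.
  by move=> x y /(congr1 val)/= /index_inj; apply.
move=> a b lt_ab; have r_trans : transitive r by move=> y x z; apply: leq_trans.
have s_sorted : sorted r s by apply: sort_sorted => x y; apply: leq_total.
have := sorted_ltn_nth r_trans a s_sorted.
move=> /(_ (index a s) (index b s)); rewrite !inE !size_s !lt_s !nth_index //.
exact.
Qed.

Lemma val_ordS n (i : 'I_n) : val (ordS i) = if i.+1 == n then 0 else i.+1.
Proof.
rewrite /=; case: eqP => [->|ne]; first by rewrite modnn.
by rewrite modn_small //; have := ltn_ord i; lia.
Qed.

(** Applied twice, the condition says that every edge spans a clique on the interval
    of labels between its ends. *)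
Definition interval_labelling (U : finType) (g : rel U) (lab : U -> 'I_#|U|) :=
  bijective lab /\ forall a b c : U, lab a < lab b -> lab b < lab c ->
    g a c -> g a b /\ g b c.

Section ConeGraphs.

Variables (T : finType) (e : rel T).
Hypotheses (e_sym : symmetric e) (e_irr : irreflexive e).

Lemma interval_closed (U : finType) (g : rel U) lab :
  symmetric g -> interval_labelling g lab -> closed_graph g.
Proof.
move=> g_sym [lab_bij lab_int]; exists lab; split=> // i j r l gij grl lt_ij lt_rl.
have lab_inj := bij_inj lab_bij; split=> [ir jl|jl ir].
  subst r; have [lt|lt|/val_inj/lab_inj //] := ltngtP (lab j) (lab l).
    by have [] := lab_int _ _ _ lt_ij lt grl.
  by rewrite g_sym; have [] := lab_int _ _ _ lt_rl lt gij.
subst l; have [lt|lt|/val_inj/lab_inj //] := ltngtP (lab i) (lab r).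
  by have [] := lab_int _ _ _ lt lt_rl gij.
by rewrite g_sym; have [] := lab_int _ _ _ lt lt_ij grl.
Qed.

Lemma cone_sym : symmetric (cone e).
Proof. by move=> [x|] [y|] //=. Qed.

(** Of three independent vertices, two have their labels on the same side of the
    label of the apex, and closedness makes them adjacent. *)
Lemma closed_cone_triangle_free :
  closed_graph (cone e) -> triangle_free (independence_complex e).
Proof.
move=> [lab [lab_bij lab_cl]] a b c ab ac bc; apply/negP.
rewrite inE => /forall_inP ind.
have nadj x y : x \in [set a; b; c] -> y \in [set a; b; c] -> x != y -> ~~ e x y.
  by move=> xs ys xy; have /forall_inP/(_ y ys)/implyP := ind x xs; apply.
have side x y : x \in [set a; b; c] -> y \in [set a; b; c] -> x != y ->
    (lab None < lab (Some x)) = ~~ (lab None < lab (Some y)).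
  move=> xs ys xy; have neN z : lab (Some z) != lab None.
    by apply/eqP => /(bij_inj lab_bij).
  have exy : e x y = false by apply/negbTE/nadj.
  have nxy : Some x <> Some y by case=> E; rewrite E eqxx in xy.
  have lt_N z : ~~ (lab None < lab (Some z)) -> lab (Some z) < lab None.
    by rewrite -leqNgt leq_eqVlt val_eqE (negbTE (neN z)).
  have [ltx|/lt_N ltx] := boolP (lab None < _); have [lty|/lt_N lty] := boolP (lab None < _) => //.
    have [/(_ erefl nxy) + _] := @lab_cl None (Some x) None (Some y) isT isT ltx lty.
    by rewrite /= exy.
  have [_ /(_ erefl nxy)] := @lab_cl (Some x) None (Some y) None isT isT ltx lty.
  by rewrite /= exy.
have := side a b; have := side a c; have := side b c.
rewrite !inE !eqxx ?orbT ab ac bc => /(_ isT isT isT) -> /(_ isT isT isT) -> /(_ isT isT isT).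
by case: (_ < _).
Qed.

(** The two neighbours of the vertex of smallest label in an induced cycle are
    adjacent. *)
Lemma closed_cone_chordal : closed_graph (cone e) -> chordal e.
Proof.
move=> [lab [lab_bij lab_cl]] n n3 [f [f_inj fE]].
have n0 : 0 < n by lia.
pose i := [arg min_(j < Ordinal n0) lab (Some (f j))].
have mini j : lab (Some (f i)) <= lab (Some (f j)) by rewrite /i; case: arg_minnP => // i0 _; apply.
have lt_i j : j != i -> lab (Some (f i)) < lab (Some (f j)).
  move=> ji; rewrite ltn_neqAle mini andbT; apply: contra ji => /eqP E.
  by apply/eqP/f_inj; have [->] := bij_inj lab_bij (val_inj E).
(* The neighbours of f i on the cycle are f p and f (ordS i). *)
have [p pE] : exists p, ordS p = i by exists (ord_pred i); rewrite ord_predK.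
have [pi si ps ss] : [/\ p != i, ordS i != i, p != ordS i & p != ordS (ordS i)].
  have := congr1 val pE; rewrite -!val_eqE !val_ordS; move: (ltn_ord i) (ltn_ord p).
  rewrite -![nat_of_ord _]/(val _); move: (val i) (val p) => vi vp.
  by do ![case: (_ =P n)] => *; split; apply/eqP; lia.
have eis : e (f i) (f (ordS i)) by rewrite fE eqxx.
have eip : e (f i) (f p) by rewrite fE pE eqxx orbT.
have [/(_ erefl) H _] := @lab_cl (Some (f i)) (Some (f p)) (Some (f i)) (Some (f (ordS i)))
  eip eis (lt_i _ pi) (lt_i _ si).
have /H/= : Some (f p) <> Some (f (ordS i)) by case=> /f_inj E; rewrite E eqxx in ps.
by rewrite fE pE (negbTE si) (negbTE ss).
Qed.


Lemma chordal_seq (s : seq T) x0 : chordal e -> 3 < size s -> uniq s ->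
  ~ (forall i j, i < size s -> j < size s -> i < j ->
       e (nth x0 s i) (nth x0 s j) = (j == i.+1) || ((i == 0) && (j.+1 == size s))).
Proof.
move=> chT s3 us sE; apply: (chT (size s) s3).
exists (fun i : 'I_(size s) => nth x0 s i); split.
  by move=> i j /eqP; rewrite nth_uniq // => /eqP/val_inj.
move=> i j; rewrite -!val_eqE !val_ordS /=; move: (ltn_ord i) (ltn_ord j).
move: (nat_of_ord i) (nat_of_ord j) => {}i {}j lti ltj.
have [lt|lt|->] := ltngtP i j.
- by rewrite sE //; apply/idP/idP; do ![case: (_ =P size s)] => *; lia.
- by rewrite e_sym sE //; apply/idP/idP; do ![case: (_ =P size s)] => *; lia.
- by rewrite e_irr; symmetry; apply/idP; do ![case: (_ =P size s)] => *; lia.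
Qed.

Hypothesis chT : chordal e.
Hypothesis tfT : triangle_free (independence_complex e).

Lemma no_induced_C4 a b c d : a != c -> b != d ->
  e a b -> e b c -> e c d -> e d a -> ~~ e a c -> ~~ e b d -> False.
Proof.
move=> ac bd eab ebc ecd eda nac nbd.
have ne x y : e x y -> x != y by apply: contraTneq => ->; rewrite e_irr.
apply: (@chordal_seq [:: a; b; c; d] a chT) => //=.
  by rewrite !inE !negb_or ac bd !ne //; rewrite e_sym.
move=> [|[|[|[|//]]]] [|[|[|[|//]]]] //= _ _ _; rewrite ?eab ?ebc ?ecd //.
- exact/negbTE.
- by rewrite e_sym eda.
- exact/negbTE.
Qed.

Lemma no_induced_C5 a b c d f : a != c -> a != d -> b != d -> b != f -> c != f ->
  e a b -> e b c -> e c d -> e d f -> e f a ->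
  ~~ e a c -> ~~ e a d -> ~~ e b d -> ~~ e b f -> ~~ e c f -> False.
Proof.
move=> ac ad bd bf cf eab ebc ecd edf efa nac nad nbd nbf ncf.
have ne x y : e x y -> x != y by apply: contraTneq => ->; rewrite e_irr.
apply: (@chordal_seq [:: a; b; c; d; f] a chT) => //=.
  by rewrite !inE !negb_or ac ad bd bf cf !ne //; rewrite e_sym.
move=> [|[|[|[|[|//]]]]] [|[|[|[|[|//]]]]] //= _ _ _; rewrite ?eab ?ebc ?ecd ?edf //;
  try exact/negbTE.
by rewrite e_sym efa.
Qed.

Lemma no_independent_triple a b c : a != b -> a != c -> b != c ->
  ~~ e a b -> ~~ e a c -> ~~ e b c -> False.
Proof.
move=> ab ac bc nab nac nbc; have /negP := tfT ab ac bc; apply.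
rewrite inE; apply/forall_inP => x xs; apply/forall_inP => y ys; apply/implyP.
by move: xs ys; rewrite !inE => /orP[/orP[]|] /eqP -> /orP[/orP[]|] /eqP ->;
  rewrite ?eqxx // e_sym.
Qed.

(* The adjacency of the complementary graph. *)
Let H x y := (x != y) && ~~ e x y.

(** The complement [H] of the graph has no triangle, no pair of disjoint edges
    without a third edge between them and no induced 5-cycle, as the complements of
    the last two graphs are cycles. Let [a] be of maximal degree in [H]. Its
    neighbours are independent in [H]; so are the other vertices. Indeed, if [x] and [y]
    were two of them adjacent in [H], each neighbour of [a] would be adjacent to one
    of them; either both are needed, which makes a 5-cycle, or one of them, say [x], is
    adjacent to all the neighbours of [a] and to [y], contradicting the choice of
    [a]. *)
Lemma two_cliques : exists B : {set T},
  (forall x y, x \in B -> y \in B -> x != y -> e x y) /\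
  (forall x y, x \notin B -> y \notin B -> x != y -> e x y).
Proof.
have [a0 _|T0] := pickP (@predT T); last first.
  by exists set0; split=> x; have := T0 x.
pose N x := [set y | H x y]; pose a := [arg max_(x > a0) #|N x|].
have maxa x : #|N x| <= #|N a| by rewrite /a; case: arg_maxnP => // a1 _; apply.
have Hsym x y : H x y = H y x by rewrite /H eq_sym e_sym.
have nH x y : x != y -> ~~ H x y -> e x y by rewrite /H => ->; rewrite negbK.
have tri x y z : H x y -> H y z -> H x z -> False.
  by move=> /andP[xy nxy] /andP[yz nyz] /andP[xz nxz]; apply: (@no_independent_triple x y z).
have Hne x y : H x y -> x != y by case/andP.
have Hnn x y : H x y -> ~~ e x y by case/andP.
exists (N a); split=> [x y|x y]; rewrite !inE => ax ay xy; apply: (nH _ _) => //.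
  by apply/negP => hxy; apply: (tri a x y).
apply/negP => hxy.
have nax : a != x.
  by apply: contraNneq ay => ->.
have nay : a != y.
  by apply: contraNneq ax => ->; rewrite Hsym.
have eax := nH _ _ nax ax; have eay := nH _ _ nay ay.
have bne b z : H a b -> ~~ H a z -> b != z by move=> hab; apply: contraNneq => <-.
have dich b : H a b -> H b x || H b y.
  move=> hab; apply: contraT; rewrite negb_or => /andP[nbx nby].
  have ebx := nH _ _ (bne _ _ hab ax) nbx; have eby := nH _ _ (bne _ _ hab ay) nby.
  have [] := @no_induced_C4 a x b y (Hne _ _ hab) xy eax _ eby _ (Hnn _ _ hab) (Hnn _ _ hxy).
    by rewrite e_sym.
  by rewrite e_sym.
have sub x' y' : H x' y' -> ~~ H a y' -> (forall b, H a b -> H b x') -> False.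
  move=> hxy' nay' all_x; have : N a \proper N x'.
    apply/properP; split; first by apply/subsetP => b; rewrite !inE (Hsym x'); apply: all_x.
    by exists y'; rewrite !inE.
  by move/proper_card; rewrite ltnNge maxa.
have [/existsP[b /andP[hab nbx]]|] := boolP [exists b, H a b && ~~ H b x]; last first.
  rewrite negb_exists => /forallP all_x; apply: (sub x y) => // b hab.
  by have := all_x b; rewrite hab negbK.
have [/existsP[b' /andP[hab' nby]]|] := boolP [exists b, H a b && ~~ H b y]; last first.
  rewrite negb_exists => /forallP all_y; apply: (sub y x) => [||b1 hab1] //.
    by rewrite Hsym.
  by have := all_y b1; rewrite hab1 negbK.
have hby : H b y by have := dich b hab; rewrite (negbTE nbx).
have hb'x : H b' x by have := dich b' hab'; rewrite (negbTE nby) orbF.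
have bb' : b != b' by apply: contraNneq nbx => ->.
have ebb' : e b' b.
  by rewrite e_sym; apply: (nH _ _) => //; apply/negP => hbb'; apply: (tri a b b').
(* The complement of the 5-cycle a - b - y - x - b' - a. *)
apply: (@no_induced_C5 a x b b' y) => //.
- exact: Hne.
- exact: Hne.
- by rewrite eq_sym; exact: Hne.
- exact: Hne.
- by rewrite e_sym; apply: (nH _ _) => //; apply: (bne _ _)=> //.
- by rewrite e_sym.
- by apply: (nH _ _) => //; apply: (bne _ _)=> //.
- by rewrite e_sym.
- exact: Hnn.
- exact: Hnn.
- by rewrite e_sym; exact: Hnn.
- exact: Hnn.
- exact: Hnn.
Qed.

Let nb (C : {set T}) x := [set z in C | e x z].

(** Two vertices of a clique with incomparable neighbourhoods in another one would
    give an induced 4-cycle. *)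
Lemma nested_nbhd (A B : {set T}) x x' : [disjoint A & B] ->
    (forall y z, y \in A -> z \in A -> y != z -> e y z) ->
    (forall y z, y \in B -> z \in B -> y != z -> e y z) ->
    x \in A -> x' \in A -> #|nb B x| <= #|nb B x'| ->
  nb B x \subset nb B x'.
Proof.
move=> dAB Acl Bcl xA x'A le; apply: contraT => /subsetPn[b].
rewrite !inE => /andP[bB exb]; rewrite bB /= => nx'b.
have : ~~ (nb B x' \proper nb B x) by apply/negP => /proper_card; rewrite ltnNge le.
move/negP; case; apply/properP; split; last by exists b; rewrite !inE bB.
apply/subsetP => b'; rewrite !inE => /andP[b'B ex'b']; rewrite b'B /=.
apply: contraT => nxb'.
have xx' : x != x' by apply: contraNneq nx'b => <-.
have bb' : b != b' by apply: contraNneq nx'b => ->.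
have xb' : x != b' by apply: contraTneq b'B => <-; rewrite (disjointFr dAB).
have bx' : b != x' by apply: contraTneq bB => ->; rewrite (disjointFr dAB).
case: (@no_induced_C4 x b b' x') => //.
- exact: Bcl.
- by rewrite e_sym.
- by rewrite e_sym; apply: Acl.
- by rewrite e_sym.
Qed.

(** With the cliques [A] and [B] of [two_cliques], list first [A] by increasing
    neighbourhood in [B], then the apex, then [B] by decreasing neighbourhood in
    [A]. *)
Theorem cone_interval_labelling : exists lab, interval_labelling (cone e) lab.
Proof.
have [B [Bcl Acl']] := two_cliques; pose A := ~: B.
have Acl x y : x \in A -> y \in A -> x != y -> e x y by rewrite !inE; apply: Acl'.
have dAB : [disjoint A & B] by rewrite -setI_eq0 setIC setICr.
have dBA : [disjoint B & A] by rewrite disjoint_sym.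
have [n leT] : exists n, forall S : {set T}, #|S| <= n.
  by exists #|T| => S; apply: max_card.
pose key u := match u with
  | None => n.+1
  | Some x => if x \in B then n.+2 + (n - #|nb A x|) else #|nb B x|
  end.
have [lab [lab_bij lab_key]] := @sorting_bijection (option T) key.
exists lab; split=> // u v w lt_uv lt_vw.
have ne p q : lab p < lab q -> p <> q by move=> lt E; rewrite E ltnn in lt.
have := ne _ _ (ltn_trans lt_uv lt_vw); have := ne _ _ lt_uv; have := ne _ _ lt_vw.
have := lab_key _ _ lt_uv; have := lab_key _ _ lt_vw.
have sne (x y : T) : Some x <> Some y -> x != y by move=> ne1; apply/eqP => xy; apply: ne1; rewrite xy.
case: u v w {lt_uv lt_vw} => [a|] [b|] [c|] //=.
- move=> + + /sne bc /sne ab /sne ac eac; have [aB|aA] := boolP (a \in B).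
    have [bB|bA] := boolP (b \in B); last by have := leT (nb B b); lia.
    have [cB|cA] := boolP (c \in B); last by have := leT (nb B c); lia.
    by move=> _ _; split; apply: Bcl.
  have [bB|bA] := boolP (b \in B).
    have [cB|cA] := boolP (c \in B); last by have := leT (nb B c); lia.
    move=> le_bc _; split; last exact: Bcl.
    have le : #|nb A c| <= #|nb A b| by have := leT (nb A c); have := leT (nb A b); lia.
    by have /subsetP/(_ a) := nested_nbhd dBA Bcl Acl cB bB le; rewrite !inE aA e_sym eac e_sym => /(_ isT).
  have [cB|cA] := boolP (c \in B) => _ le_ab; last by split; apply: Acl'.
  split; first exact: Acl'.
  have aA' : a \in A by rewrite inE.
  have bA' : b \in A by rewrite inE.
  by have /subsetP/(_ c) := nested_nbhd dAB Acl Bcl aA' bA' le_ab; rewrite !inE cB eac => /(_ isT).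
- move=> + + _ /sne ab _ _; have [bB|bA] := boolP (b \in B); first by lia.
  have [aB|aA] := boolP (a \in B); first by have := leT (nb B b); lia.
  by move=> _ _; split => //; apply: Acl'.
- move=> + + /sne bc _ _ _; have [bB|bA] := boolP (b \in B); last by have := leT (nb B b); lia.
  have [cB|cA] := boolP (c \in B); last by have := leT (nb B c); lia.
  by move=> _ _; split => //; apply: Bcl.
Qed.


End ConeGraphs.

Local Open Scope ring_scope.

(** * Setting variables of a polynomial ring to zero *)

Section PolynomialTools.

Variables (k : fieldType) (n : nat).
Implicit Types (p q : {mpoly k[n]}) (Z : pred 'I_n).

Lemma pihomogM d e p q :
  q \is e.-homog -> pihomog mdeg (d + e) (p * q) = pihomog mdeg d p * q.
Proof.
move=> hq; rewrite {1}[p](mpolyE p) mulr_suml raddf_sum /= pihomogE mulr_suml.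
rewrite [RHS]big_mkcond /=; apply: eq_bigr => m _.
rewrite -scalerAl linearZ /=; have hm : 'X_[m] * q \is (mdeg m + e).-homog.
  by apply: dhomogM => //; rewrite dhomogX.
case: eqP => [<-|ne]; first by rewrite pihomog_dE // scalerAl.
by rewrite (pihomog_ne0 _ hm) ?scaler0 // eqn_add2r; apply/eqP.
Qed.

Lemma pihomogM_lt d e p q :
  (d < e)%N -> q \is e.-homog -> pihomog mdeg d (p * q) = 0.
Proof.
move=> lt_de hq; rewrite {1}[p](mpolyE p) mulr_suml raddf_sum /= big1 // => m _.
rewrite -scalerAl linearZ /= (@pihomog_ne0 _ _ _ (mdeg m + e)%N) ?scaler0 //.
- by rewrite gtn_eqF // ltn_addl.
- by apply: dhomogM => //; rewrite dhomogX.
Qed.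

(** The retraction of the polynomial ring onto the subring of the variables
    outside [Z]. *)
Definition zeroing Z p : {mpoly k[n]} :=
  mmap (@mpolyC n k) (fun i => if Z i then 0 else 'X_i) p.

Lemma zeroing_is_zmod_morphism Z : zmod_morphism (zeroing Z).
Proof. by move=> p q; rewrite /zeroing raddfB. Qed.

Lemma zeroing_is_monoid_morphism Z : monoid_morphism (zeroing Z).
Proof. by split=> [|p q]; rewrite /zeroing ?rmorph1 // rmorphM. Qed.

HB.instance Definition _ Z := GRing.isZmodMorphism.Build
  {mpoly k[n]} {mpoly k[n]} (zeroing Z) (zeroing_is_zmod_morphism Z).
HB.instance Definition _ Z := GRing.isMonoidMorphism.Build
  {mpoly k[n]} {mpoly k[n]} (zeroing Z) (zeroing_is_monoid_morphism Z).

Lemma zeroingX Z i : zeroing Z 'X_i = if Z i then 0 else 'X_i.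
Proof. by rewrite /zeroing mmapX mmap1U. Qed.

Definition avoids Z (m : 'X_{1..n}) := [forall i, Z i ==> (m i == 0%N)].

Lemma zeroingXm Z (m : 'X_{1..n}) :
  zeroing Z 'X_[m] = if avoids Z m then 'X_[m] else 0.
Proof.
rewrite /zeroing mmapX /mmap1; case: ifPn => [/forallP av|].
  rewrite mpolyXE_id; apply: eq_bigr => i _; by have := av i; case: ifP => //= _ /eqP ->; rewrite !expr0.
rewrite /avoids negb_forall => /existsP[i]; rewrite negb_imply => /andP[Zi mi].
by rewrite (bigD1 i) //= Zi expr0n (negbTE mi) mul0r.
Qed.

Lemma zeroingE Z p :
  zeroing Z p = \sum_(m <- msupp p | avoids Z m) p@_m *: 'X_[m].
Proof.
rewrite {1}[p]mpolyE raddf_sum /= [RHS]big_mkcond; apply: eq_bigr => m _ /=.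
rewrite -mul_mpolyC rmorphM /= zeroingXm.
rewrite {1}/zeroing mmapC !mul_mpolyC.
by case: ifP => //; rewrite scaler0.
Qed.

Lemma zeroing_coeff Z p m : avoids Z m -> (zeroing Z p)@_m = p@_m.
Proof.
move=> av; rewrite zeroingE [in RHS](mpolyE p) !raddf_sum /= [LHS]big_mkcond /=.
apply: eq_bigr => m' _; case: ifPn => // nav.
by rewrite mcoeffZ mcoeffX; case: eqP nav => [->|_]; rewrite ?av // mulr0.
Qed.

Lemma zeroing_homog Z d p : p \is d.-homog -> zeroing Z p \is d.-homog.
Proof.
move=> hp; rewrite zeroingE big_seq_cond; apply: rpred_sum => m /andP[m_p _].
by apply: rpredZ; rewrite dhomogX; apply/eqP; move/dhomogP: hp; apply.
Qed.

Lemma zeroing_dvd i p : exists q, p = 'X_i * q + zeroing (pred1 i) p.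
Proof.
exists (\sum_(m <- msupp p | m i != 0%N) p@_m *: 'X_[m - U_(i)]).
rewrite {1}[p]mpolyE (bigID (fun m : 'X_{1..n} => m i != 0%N)) /= zeroingE.
congr (_ + _).
  rewrite mulr_sumr; apply: eq_bigr => m mi; rewrite -scalerAr; congr (_ *: _).
  rewrite mulrC -mpolyXD submK //; apply/mnm_lepP => j; rewrite mnm1E.
  by case: eqP => // <-; rewrite lt0n.
apply: eq_bigl => m; rewrite negbK; apply/idP/forallP => [/eqP mi j|/(_ i)].
  by apply/implyP => /eqP ->; rewrite mi.
by rewrite /= eqxx.
Qed.

(** If zeroing [Z v] kills [p], every monomial of [p] involves a variable of
    [Z v]; doing so for more than [d] disjoint sets forces the degree above
    [d]. *)
Lemma zeroing_eq0 (I : finType) (P : pred I) (Z : I -> pred 'I_n) d p :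
    (forall u v i, P u -> P v -> Z u i -> Z v i -> u = v) ->
    p \is d.-homog -> (d < #|P|)%N ->
    (forall v, P v -> zeroing (Z v) p = 0) -> p = 0.
Proof.
move=> disj hp lt_d Zp0; apply/mpolyP => m; rewrite mcoeff0; apply/eqP.
apply: contraT; rewrite -mcoeff_msupp => m_p.
have meet v : P v -> exists i, Z v i && (m i != 0%N).
  move=> Pv; apply/existsP; apply: contraT; rewrite negb_exists => /forallP av.
  have : avoids (Z v) m.
    by apply/forallP => i; move: (av i); rewrite negb_and negbK implybE.
  move=> /zeroing_coeff => /(_ p); rewrite Zp0 // mcoeff0 => /esym/eqP.
  by rewrite mcoeff_eq0 m_p.
have /dhomogP/(_ m m_p) dm := hp.
suff : (#|P| <= d)%N by rewrite leqNgt lt_d.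
rewrite -dm /= mdegE -sum1_card.
apply: (@leq_trans (\sum_(v | P v) \sum_(i | Z v i) m i)).
  apply: leq_sum => v Pv; have [i /andP[Zi mi]] := meet v Pv.
  by rewrite (bigD1 i) //= ltn_addr // lt0n.
rewrite (exchange_big_dep predT) //=; apply: leq_sum => i _.
have [v0 /andP[Pv0 Zv0]|none] := pickP (fun v => P v && Z v i).
  rewrite (big_pred1 v0) // => v /=; apply/idP/eqP => [/andP[Pv Zv]|->].
    exact: disj Zv Zv0.
  by rewrite Pv0.
by rewrite big_pred0.
Qed.

End PolynomialTools.

Lemma zeroing_mderiv (k : fieldType) n (Z : pred 'I_n) (p : {mpoly k[n]}) i :
  Z i -> (zeroing Z p)^`M(i) = 0.
Proof.
move=> Zi; rewrite zeroingE raddf_sum big1 //= => m /forallP/(_ i).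
by rewrite Zi => /eqP mi; rewrite mderivZ mderivX mi scale0r scaler0.
Qed.

Lemma mderiv_homog (k : fieldType) n (p : {mpoly k[n]}) i d :
  p \is d.+1.-homog -> p^`M(i) \is d.-homog.
Proof.
move=> hp; rewrite [p]mpolyE raddf_sum big_seq /=; apply: rpred_sum => m m_p.
rewrite mderivZ mderivX; apply: rpredZ; have [->|mi] := eqVneq (m i) 0%N.
  by rewrite scale0r rpred0.
apply: rpredZ; rewrite dhomogX.
have /dhomogP/(_ m m_p)/= dm := hp.
rewrite -eqSS -dm -[in X in _ == X](@submK _ U_(i)%MM m) ?mdegD ?mdeg1 ?addn1 //.
by apply/mnm_lepP => j; rewrite mnm1E; case: eqP => // <-; rewrite lt0n.
Qed.

Lemma mderiv_homog0 (k : fieldType) n (p : {mpoly k[n]}) i :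
  p \is 0.-homog -> p^`M(i) = 0.
Proof.
move=> hp; rewrite [p]mpolyE raddf_sum big_seq big1 //= => m m_p.
have /dhomogP/(_ m m_p)/eqP/= := hp; rewrite mdeg_eq0 => /eqP ->.
by rewrite mderivZ mderivX mnm0E scale0r scaler0.
Qed.

(** * Homogeneous lifts to a presentation by polynomials *)

Section GradedQuotient.

Variables (k : fieldType) (n : nat) (A : comNzRingType).
Variable pi : {rmorphism {mpoly k[n]} -> A}.
Hypothesis pi_surj : forall a, exists p, a = pi p.
Hypothesis pi_homog : forall p d, pi p = 0 -> pi (pihomog mdeg d p) = 0.

Notation S := {mpoly k[n]}.

Definition img_grading (d : nat) (a : A) := exists p, p \is d.-homog /\ a = pi p.

Definition mx_gr a b d (M : 'M[A]_(a, b)) := forall i j, img_grading d (M i j).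
Definition mx_homog a b d (M : 'M[S]_(a, b)) := forall i j, M i j \is d.-homog.

Lemma mx_lift_gr a b d (M : 'M[A]_(a, b)) :
  mx_gr d M -> exists L, mx_homog d L /\ M = map_mx pi L.
Proof.
move=> grM; have /choice[f fP] : forall ij : 'I_a * 'I_b, exists p : S,
    p \is d.-homog /\ M ij.1 ij.2 = pi p by move=> [i j]; exact: grM.
exists (\matrix_(i, j) f (i, j)); split=> [i j|]; first by rewrite mxE (fP _).1.
by apply/matrixP => i j; rewrite !mxE -(fP (i, j)).2.
Qed.

Lemma mx_lift a b (M : 'M[A]_(a, b)) : exists L, M = map_mx pi L.
Proof.
have /choice[f fP] : forall ij : 'I_a * 'I_b, exists p : S, M ij.1 ij.2 = pi p.
  by move=> ij; exact: pi_surj.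
by exists (\matrix_(i, j) f (i, j)); apply/matrixP => i j; rewrite !mxE -fP.
Qed.

Lemma mx_gr_map a b d (L : 'M[S]_(a, b)) : mx_homog d L -> mx_gr d (map_mx pi L).
Proof. by move=> hL i j; exists (L i j); rewrite mxE. Qed.

Lemma mx_homogM a b c d e (L : 'M[S]_(a, b)) (M : 'M[S]_(b, c)) :
  mx_homog d L -> mx_homog e M -> mx_homog (d + e) (L *m M).
Proof.
by move=> hL hM i j; rewrite mxE; apply: rpred_sum => l _; apply: dhomogM.
Qed.

Lemma pihomog_mx a b c d e (w : 'M[S]_(a, b)) (D : 'M[S]_(b, c)) :
    mx_homog e D ->
  map_mx (pihomog mdeg (d + e)) (w *m D) = map_mx (pihomog mdeg d) w *m D.
Proof.
move=> hD; apply/matrixP => i j; rewrite !mxE raddf_sum /=.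
by apply: eq_bigr => l _; rewrite mxE pihomogM.
Qed.

Lemma pihomog_mx_id a b d (L : 'M[S]_(a, b)) :
  mx_homog d L -> map_mx (pihomog mdeg d) L = L.
Proof. by move=> hL; apply/matrixP => i j; rewrite mxE pihomog_dE. Qed.

Lemma pi_homog_mx a b d (L : 'M[S]_(a, b)) :
  map_mx pi L = 0 -> map_mx pi (map_mx (pihomog mdeg d) L) = 0.
Proof.
move=> L0; apply/matrixP => i j; rewrite !mxE pi_homog //.
by move/matrixP/(_ i j): L0; rewrite !mxE.
Qed.

(** A linear system over [A] whose coefficients and right-hand side are
    homogeneous, if solvable at all, has a homogeneous solution: lift it to
    polynomials and keep the component of the right degree, which is legitimate
    because the kernel of [pi] is homogeneous. *)
Lemma gr_solve a b c d e (u : 'M[A]_(a, c)) (D : 'M[A]_(b, c)) :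
    mx_gr (d + e) u -> mx_gr e D -> (exists w, u = w *m D) ->
  exists w, mx_gr d w /\ u = w *m D.
Proof.
move=> /mx_lift_gr[u' [hu ->]] /mx_lift_gr[D' [hD ->]] [w].
have [w' ->] := mx_lift w; rewrite -map_mxM => /eqP.
rewrite -subr_eq0 -map_mxB => /eqP /(@pi_homog_mx _ _ (d + e)).
rewrite map_mxB pihomog_mx // (pihomog_mx_id hu) => /eqP.
rewrite map_mxB map_mxM subr_eq0 => /eqP eu.
exists (map_mx pi (map_mx (pihomog mdeg d) w')); split=> //.
by apply: mx_gr_map => i j; rewrite mxE pihomogP.
Qed.

Lemma solve_rows a b c (u : 'M[A]_(a, c)) (D : 'M[A]_(b, c)) :
  (forall i, exists w : 'rV_b, row i u = w *m D) -> exists w, u = w *m D.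
Proof.
move=> /choice[f fP]; exists (\matrix_i f i).
by apply/row_matrixP => i; rewrite fP row_mul rowK.
Qed.

Lemma irrelevant_gr d a : img_grading d.+1 a -> irrelevant_ideal img_grading a.
Proof.
move=> gra; exists [:: a]; rewrite big_seq1; split=> // x.
by rewrite inE => /eqP ->; exists d.
Qed.

Lemma irrelevant_lift a :
  irrelevant_ideal img_grading a -> exists p, a = pi p /\ pihomog mdeg 0 p = 0.
Proof.
case=> s [sP ->]; elim: s sP => [|x s IHs] sP.
  by exists 0; rewrite big_nil !raddf0.
have [|q [qE q0]] := IHs; first by move=> y ys; apply: sP; rewrite inE ys orbT.
have [d [p [hp px]]] := sP x (mem_head _ _).
exists (p + q); rewrite big_cons qE px rmorphD; split=> //.
by rewrite raddfD /= q0 addr0 (@pihomog_ne0 _ _ _ d.+1).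
Qed.

End GradedQuotient.

(** * An obstruction to Koszulness from the linear part of the relations *)

(** Split the variables into those outside [Z], which generate a polynomial ring
    [Q], the variables [v i], and the remaining ones, which are ignored. The part
    of [A] of degree at most one in the [v i] is [Q] plus the [Q]-module [M]
    presented by the matrix of linear forms [phi]. The theorem below says that if
    [A] is Koszul, then the syzygies of [phi] cannot start in degree two or
    more. *)
Section Obstruction.

Variables (k : fieldType) (n : nat) (A : comNzRingType).
Variable pi : {rmorphism {mpoly k[n]} -> A}.
Hypothesis pi_surj : forall a, exists p, a = pi p.
Hypothesis pi_homog : forall p d, pi p = 0 -> pi (pihomog mdeg d p) = 0.

Notation S := {mpoly k[n]}.
Notation gr := (img_grading pi).

Variables (Z : pred 'I_n) (r s : nat) (v : 'I_s -> 'I_n).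
Hypotheses (v_inj : injective v) (Zv : forall i, Z (v i)).

Notation rho0 := (zeroing Z).
(** The coefficient of ['X_(v i)] in the part of [p] linear in the [v i]. *)
Definition linear_part (i : 'I_s) (p : S) : S := rho0 (p^`M(v i)).
Notation rho1 := linear_part.

Variable phi : 'M[S]_(r, s).
Hypothesis phi_homog : mx_homog 1 phi.
Hypothesis rho0_phi : map_mx rho0 phi = phi.
Hypothesis phi_rel : forall e, pi (\sum_i phi e i * 'X_(v i)) = 0.
Hypothesis rho0_ker : forall p, pi p = 0 -> rho0 p = 0.
Hypothesis rho1_ker : forall p, pi p = 0 ->
  exists c : 'I_r -> S, forall i, rho1 i p = \sum_e phi e i * c e.

Variable d : nat.
Hypothesis phi_free : forall (c : 'I_r -> S) d', (d' < d)%N ->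
  (forall e, c e \is d'.-homog) -> (forall i, \sum_e phi e i * c e = 0) ->
  forall e, c e = 0.

Fact linear_part_is_zmod_morphism i : zmod_morphism (rho1 i).
Proof. by move=> p q; rewrite /rho1 mderivB rmorphB. Qed.
HB.instance Definition _ i :=
  GRing.isZmodMorphism.Build S S (rho1 i) (linear_part_is_zmod_morphism i).

Lemma linear_part_mx i a b c (L : 'M[S]_(a, b)) (M : 'M[S]_(b, c)) :
  map_mx (rho1 i) (L *m M) =
    map_mx (rho1 i) L *m map_mx rho0 M + map_mx rho0 L *m map_mx (rho1 i) M.
Proof.
apply/matrixP => x y; rewrite !mxE raddf_sum -big_split; apply: eq_bigr => z _ /=.
by rewrite !mxE /rho1 mderivM rmorphD !rmorphM.
Qed.

Lemma linear_part_fixed i a b (L : 'M[S]_(a, b)) :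
  map_mx rho0 L = L -> map_mx (rho1 i) L = 0.
Proof.
move=> <-; apply/matrixP => x y.
by rewrite !mxE /rho1 zeroing_mderiv // rmorph0.
Qed.

Lemma linear_part_mx0 i a b (L : 'M[S]_(a, b)) :
  mx_homog 0 L -> map_mx (rho1 i) L = 0.
Proof.
move=> hL; apply/matrixP => x y.
by rewrite !mxE /rho1 (mderiv_homog0 _ (hL _ _)) rmorph0.
Qed.

Lemma zeroing_mx_homog a b e (L : 'M[S]_(a, b)) :
  mx_homog e L -> mx_homog e (map_mx rho0 L).
Proof. by move=> hL x y; rewrite mxE zeroing_homog. Qed.

Lemma rho0_ker_mx a b (L : 'M[S]_(a, b)) : map_mx pi L = 0 -> map_mx rho0 L = 0.
Proof.
move=> L0; apply/matrixP => x y; rewrite !mxE rho0_ker //.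
by move/matrixP/(_ x y): L0; rewrite !mxE.
Qed.

Lemma rho1_ker_mx1 i a b (L : 'M[S]_(a, b)) :
  mx_homog 1 L -> map_mx pi L = 0 -> map_mx (rho1 i) L = 0.
Proof.
move=> hL L0; apply/matrixP => x y; rewrite !mxE.
have [|c /(_ i) cE] := @rho1_ker (L x y).
  by move/matrixP/(_ x y): L0; rewrite !mxE.
have <- : pihomog mdeg 0 (rho1 i (L x y)) = rho1 i (L x y).
  by rewrite pihomog_dE // zeroing_homog // mderiv_homog.
rewrite cE raddf_sum big1 //= => e _.
by rewrite mulrC (pihomogM_lt _ (e := 1)) //; apply: phi_homog.
Qed.

(** The linear part of a relation is a combination of the rows of [phi], whose
    coefficients can be taken homogeneous. *)
Lemma rho1_ker_mx a b e0 (L : 'M[S]_(a, b)) :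
    mx_homog e0.+2 L -> map_mx pi L = 0 ->
  exists c : 'I_r -> 'M[S]_(a, b), (forall e, mx_homog e0 (c e)) /\
    forall i, map_mx (rho1 i) L = \sum_e phi e i *: c e.
Proof.
move=> hL L0.
have /choice[c cP] : forall xy : 'I_a * 'I_b, exists c : 'I_r -> S,
    forall i, rho1 i (L xy.1 xy.2) = \sum_e phi e i * c e.
  move=> [x y]; apply: rho1_ker => /=.
  by move/matrixP/(_ x y): L0; rewrite !mxE.
exists (fun e => \matrix_(x, y) pihomog mdeg e0 (c (x, y) e)); split=> [e x y|i].
  by rewrite mxE pihomogP.
apply/matrixP => x y; rewrite mxE summxE.
have <- : pihomog mdeg e0.+1 (rho1 i (L x y)) = rho1 i (L x y).
  by rewrite pihomog_dE // zeroing_homog // mderiv_homog.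
rewrite (cP (x, y)) raddf_sum /=; apply: eq_bigr => e _; rewrite !mxE.
by rewrite ![phi e i * _]mulrC -[e0.+1]addn1 pihomogM //; apply: phi_homog.
Qed.

Lemma phi_free_mx a b e0 (c c' : 'I_r -> 'M[S]_(a, b)) :
    (e0 < d)%N -> (forall e, mx_homog e0 (c e)) -> (forall e, mx_homog e0 (c' e)) ->
    (forall i, \sum_e phi e i *: c e = \sum_e phi e i *: c' e) ->
  forall e, c e = c' e.
Proof.
move=> lt hc hc' E e; apply/matrixP => x y; apply/eqP; rewrite -subr_eq0.
apply/eqP; apply: (phi_free (c := fun e => c e x y - c' e x y) lt) => [e1|i].
  by apply: rpredB; [apply: hc | apply: hc'].
move/(_ i)/matrixP/(_ x y)/eqP: E; rewrite !summxE -subr_eq0 -sumrB => /eqP E.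
by rewrite -[RHS]E; apply: eq_bigr => e1 _; rewrite !mxE mulrBr.
Qed.

(** Let [F] be a linear resolution with differentials [D0], [D1], [D2] and
    augmentation [g]. The exactness of [F] yields [E], [T] and [W] which express
    the variables [v i], the rows of [phi] and the syzygy [a] in terms of [D0],
    [D1] and [D2]. Conversely the linear parts of the equations [D1 D0 g = 0],
    [D2 D1 = 0] and [W D2 = a T] are combinations [gam], [tau], [eta] of the rows
    of [phi]. All the entries being of known degree, the absence of syzygies in
    degrees 0, 1 and [d - 1] turns the resulting identities modulo syzygies into
    equalities, which telescope to
    [a = a T gam = W D2 gam = W tau d0 = eta D1 d0 = 0],
    where [d0] is the part of [D0 g] without the variables [v i], for which
    [D1 d0 = 0]. *)
Theorem linear_part_obstruction (a : 'rV[S]_r) :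
    (1 < d)%N -> mx_homog d a -> map_mx rho0 a = a -> a *m phi = 0 ->
  koszul gr -> a = 0.
Proof.
move=> d_gt1 ha rho0_a a_phi [F linF].
have gr_D i : mx_gr pi 1 (gr_diff F i).
  by move=> p q; have := gr_diff_homog p q; rewrite !linF leqnSn subSnn.
have gr_aug : mx_gr pi 0 (gr_aug F).
  by move=> p q; have := gr_aug_homog p; rewrite linF eqxx (ord1 q).
have [D0 [hD0 D0E]] := mx_lift_gr (gr_D 0).
have [D1 [hD1 D1E]] := mx_lift_gr (gr_D 1).
have [D2 [hD2 D2E]] := mx_lift_gr (gr_D 2).
have [g [hg gE]] := mx_lift_gr gr_aug.
have compD i : gr_diff F i.+1 *m gr_diff F i = 0.
  apply/row_matrixP => p; rewrite row0 row_mul; apply/gr_exactS.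
  by exists (delta_mx 0 p); rewrite -rowE.
(* A combination of the degree zero generators of F on which the augmentation
   is exactly 1. *)
have [eps [heps epsE]] : exists eps : 'rV[S]_(gr_rank F 0),
    mx_homog 0 eps /\ map_mx pi (eps *m g) = 1%:M.
  have [u] := gr_aug_surj F; have [u' ->] := mx_lift pi_surj u.
  move=> /irrelevant_lift[q [qE q0]].
  exists (map_mx (pihomog mdeg 0) u'); split=> [i j|]; first by rewrite mxE pihomogP.
  rewrite -(pihomog_mx 0 u' hg); apply/matrixP => i j; rewrite !ord1 {i j}.
  rewrite [LHS]mxE [X in pi X]mxE [RHS]mxE eqxx mulr1n; apply/eqP; rewrite -subr_eq0; apply/eqP.
  have := pi_homog (p := (u' *m g) 0 0 - 1 - q) 0.
  rewrite !raddfB /= q0 raddf0 subr0 (pihomog_dE (dhomog1 _ _)) rmorph1.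
  move=> -> //; rewrite -qE gE.
  have -> : (map_mx pi u' *m map_mx pi g) 0 0 = pi ((u' *m g) 0 0).
    by rewrite -map_mxM mxE.
  by rewrite subrr.
pose U : 'cV[S]_s := \col_i 'X_(v i).
have hU : mx_homog 1 U by move=> i j; rewrite mxE dhomogX /= mdeg1.
have [E [hE EE]] : exists E : 'M[S]_(s, gr_rank F 1), mx_homog 0 E /\
    map_mx pi (U *m eps) = map_mx pi (E *m D0).
  have [|||E [/mx_lift_gr[E' [hE' ->]] ->]] :=
      @gr_solve _ _ _ pi pi_surj pi_homog _ _ _ 0 1 (map_mx pi (U *m eps)) (gr_diff F 0).
  - by apply: mx_gr_map; rewrite -[(0 + 1)%N]/(1 + 0)%N; apply: mx_homogM.
  - exact: gr_D.
  - apply: solve_rows => i; apply/gr_exact0.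
    apply: (@irrelevant_gr _ _ _ _ 0); rewrite gE -map_row -map_mxM -row_mul.
    rewrite -mulmxA.
    exists ('X_(v i)); rewrite dhomogX /= mdeg1; split=> //.
    rewrite row_mul map_mxM epsE mulmx1 !mxE //.
  - by exists E'; split=> //; rewrite D0E -map_mxM.
have phiU : map_mx pi (phi *m U) = 0.
  apply/matrixP => e j; rewrite !mxE -[RHS](phi_rel e); congr (pi _).
  by apply: eq_bigr => i _; rewrite mxE.
have [T [hT TE]] : exists T : 'M[S]_(r, gr_rank F 2), mx_homog 0 T /\
    map_mx pi (phi *m E) = map_mx pi (T *m D1).
  have [|||T [/mx_lift_gr[T' [hT' ->]] TE]] :=
      @gr_solve _ _ _ pi pi_surj pi_homog _ _ _ 0 1 (map_mx pi (phi *m E)) (gr_diff F 1).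
  - by apply: mx_gr_map; rewrite -[(0 + 1)%N]/(1 + 0)%N; apply: mx_homogM.
  - exact: gr_D.
  - apply: solve_rows => i; apply/gr_exactS; rewrite -row_mul D0E -map_mxM -mulmxA.
    by rewrite map_mxM -EE -map_mxM mulmxA map_mxM phiU mul0mx row0.
  - by exists T'; split=> //; rewrite TE D1E -map_mxM.
have [W [hW WE]] : exists W : 'M[S]_(1, gr_rank F 3), mx_homog d.-1 W /\
    map_mx pi (a *m T) = map_mx pi (W *m D2).
  have [|||W [/mx_lift_gr[W' [hW' ->]] WE]] :=
      @gr_solve _ _ _ pi pi_surj pi_homog _ _ _ d.-1 1 (map_mx pi (a *m T)) (gr_diff F 2).
  - apply: mx_gr_map; rewrite addn1 prednK; last exact: ltnW.
    by rewrite -[d]addn0; apply: mx_homogM.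
  - exact: gr_D.
  - apply: solve_rows => i; apply/gr_exactS; rewrite -row_mul D1E -map_mxM -mulmxA.
    by rewrite map_mxM -TE -map_mxM mulmxA a_phi mul0mx map_mx0 row0.
  - by exists W'; split=> //; rewrite WE D2E -map_mxM.
pose delta := D0 *m g; pose d0 := map_mx rho0 delta.
have hdelta : mx_homog 1 delta := mx_homogM hD0 hg.
have ker_mx a1 b1 (L M : 'M[S]_(a1, b1)) : map_mx pi L = map_mx pi M ->
    map_mx pi (L - M) = 0 by rewrite map_mxB => ->; rewrite subrr.
have ker0 a1 b1 (L M : 'M[S]_(a1, b1)) : map_mx pi L = map_mx pi M ->
    map_mx rho0 L = map_mx rho0 M.
  by move=> /ker_mx/rho0_ker_mx/eqP; rewrite map_mxB subr_eq0 => /eqP.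
have D1delta : map_mx pi (D1 *m delta) = 0.
  by rewrite mulmxA map_mxM map_mxM -D1E -D0E compD mul0mx.
have D1d0 : map_mx rho0 D1 *m d0 = 0.
  by rewrite /d0 -map_mxM rho0_ker_mx.
have [|gam [hgam gamE]] := @rho1_ker_mx _ _ 0 (D1 *m delta) _ D1delta.
  exact: (mx_homogM hD1 hdelta).
have D2D1 : map_mx pi (D2 *m D1) = 0 by rewrite map_mxM -D1E -D2E compD.
have D2D10 : map_mx rho0 D2 *m map_mx rho0 D1 = 0 by rewrite -map_mxM rho0_ker_mx.
have [|tau [htau tauE]] := @rho1_ker_mx _ _ 0 (D2 *m D1) _ D2D1.
  exact: (mx_homogM hD2 hD1).
have [|eta [heta etaE]] := @rho1_ker_mx _ _ d.-2 (W *m D2 - a *m T) _ (ker_mx _ _ _ _ (esym WE)).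
  have -> : d.-2.+2 = d by case: d d_gt1 => [|[]].
  move=> i j; rewrite mxE [X in _ + X]mxE; apply: rpredB.
    by have := mx_homogM hW hD2 i j; rewrite addn1 prednK // ltnW.
  by have := mx_homogM ha hT i j; rewrite addn0.
have E0 : map_mx rho0 T *m map_mx rho0 D1 = phi *m map_mx rho0 E.
  by rewrite -map_mxM -(ker0 _ _ _ _ TE) map_mxM rho0_phi.
(* E and T have constant entries, so their linear parts vanish. *)
have E1 i : map_mx rho0 T *m map_mx (rho1 i) D1 = 0.
  have := @rho1_ker_mx1 i _ _ (phi *m E - T *m D1) _ (ker_mx _ _ _ _ TE).
  rewrite map_mxB !linear_part_mx !(linear_part_fixed _ rho0_phi).
  rewrite !(linear_part_mx0 _ hE) !(linear_part_mx0 _ hT) mulmx0 !mul0mx !add0r.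
  move=> /(_ _)/eqP; rewrite oppr_eq0 => H; apply/eqP/H => {H} x y.
  rewrite mxE [X in _ + X]mxE; apply: rpredB.
    exact: (mx_homogM phi_homog hE).
  exact: (mx_homogM hT hD1).
have E2 i : map_mx rho0 E *m map_mx (rho1 i) delta = delta_mx i 0.
  have EU : map_mx pi (E *m delta) = map_mx pi U.
    rewrite mulmxA map_mxM -EE -map_mxM -mulmxA map_mxM epsE.
    by rewrite mulmx1.
  have := @rho1_ker_mx1 i _ _ (E *m delta - U) _ (ker_mx _ _ _ _ EU).
  rewrite map_mxB linear_part_mx (linear_part_mx0 _ hE) mul0mx add0r.
  have -> : map_mx (rho1 i) U = delta_mx i 0.
    apply/matrixP => x y; rewrite !mxE /rho1 mderivX mnm1E !ord1 eqxx andbT.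
    rewrite (inj_eq v_inj) eq_sym; case: eqP => [->|_]; last by rewrite scale0r rmorph0.
    have -> : (U_(v x) - U_(v x) = 0)%MM.
      by apply/mnmP => z; rewrite mnmBE subnn mnm0E.
    by rewrite scale1r mpolyX0 rmorph1.
  move=> /(_ _)/eqP; rewrite subr_eq0 => H; apply/eqP/H => {H} x y.
  rewrite mxE [X in _ + X]mxE; apply: rpredB; last exact: hU.
  exact: (mx_homogM hE hdelta).
have gamE' i : map_mx rho0 D1 *m map_mx (rho1 i) delta +
    map_mx (rho1 i) D1 *m d0 = \sum_e phi e i *: gam e.
  by rewrite -gamE linear_part_mx addrC.
have tauE' i : map_mx rho0 D2 *m map_mx (rho1 i) D1 =
    \sum_e phi e i *: tau e - map_mx (rho1 i) D2 *m map_mx rho0 D1.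
  by rewrite -tauE linear_part_mx addrC addKr.
have mulZ x y z (L : 'M[S]_(x, y)) (c : 'I_r -> 'M[S]_(y, z)) i :
    L *m (\sum_e phi e i *: c e) = \sum_e phi e i *: (L *m c e).
  by rewrite mulmx_sumr; apply: eq_bigr => e _; rewrite -scalemxAr.
have mulZl x y z (L : 'M[S]_(y, z)) (c : 'I_r -> 'M[S]_(x, y)) i :
    (\sum_e phi e i *: c e) *m L = \sum_e phi e i *: (c e *m L).
  by rewrite mulmx_suml; apply: eq_bigr => e _; rewrite -scalemxAl.
have hR0 := zeroing_mx_homog.
have Tgam e : map_mx rho0 T *m gam e = delta_mx e 0.
  apply: (phi_free_mx (e0 := 0) (c := fun e => _ *m gam e)
    (c' := fun e => delta_mx e 0)) => [|e'|e' x y|i].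
  - exact: ltnW.
  - exact: (mx_homogM (hR0 _ _ _ _ hT) (hgam e')).
  - by rewrite mxE; case: (_ && _); rewrite ?dhomog1 ?dhomog0.
  rewrite -mulZ -gamE' mulmxDr !mulmxA E1 mul0mx addr0 E0 -mulmxA E2.
  rewrite -colE; apply/matrixP => x y; rewrite !mxE summxE (bigD1 x) //= big1.
    by rewrite !mxE !ord1 !eqxx addr0 mulr1.
  by move=> x' ne; rewrite !mxE eq_sym (negbTE ne) mulr0.
have Dgam e : map_mx rho0 D2 *m gam e = tau e *m d0.
  apply: (phi_free_mx (e0 := 1) (c := fun e => _ *m gam e)
    (c' := fun e => tau e *m d0)) => [|e'|e'|i] //.
  - exact: (mx_homogM (hR0 _ _ _ _ hD2) (hgam e')).
  - exact: (mx_homogM (htau e') (hR0 _ _ _ _ hdelta)).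
  rewrite -mulZ -gamE' mulmxDr !mulmxA D2D10 mul0mx add0r tauE' mulmxBl mulZl.
  by rewrite -mulmxA D1d0 mulmx0 subr0.
have W0 : map_mx rho0 W *m map_mx rho0 D2 = a *m map_mx rho0 T.
  by rewrite -map_mxM -(ker0 _ _ _ _ WE) map_mxM rho0_a.
have Wtau e : map_mx rho0 W *m tau e = eta e *m map_mx rho0 D1.
  apply: (phi_free_mx (e0 := d.-1) (c := fun e => _ *m tau e)
    (c' := fun e => eta e *m _)) => [|e'|e'|i] //.
  - by rewrite prednK // ltnW.
  - by have := mx_homogM (hR0 _ _ _ _ hW) (htau e'); rewrite addn0.
  - have := mx_homogM (heta e') (hR0 _ _ _ _ hD1); rewrite addn1.
    by case: d d_gt1 => [|[]].
  rewrite -mulZ -mulZl -etaE map_mxB !linear_part_mx (linear_part_fixed _ rho0_a).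
  rewrite (linear_part_mx0 _ hT) mulmx0 mul0mx addr0 subr0.
  rewrite mulmxDl -!mulmxA D2D10 mulmx0 add0r.
  have -> : \sum_e phi e i *: tau e = map_mx rho0 D2 *m map_mx (rho1 i) D1 +
      map_mx (rho1 i) D2 *m map_mx rho0 D1 by rewrite tauE' subrK.
  by rewrite mulmxDr mulmxA W0 -mulmxA E1 mulmx0 add0r.
apply/rowP => e; rewrite [RHS]mxE.
have -> : a 0 e = (a *m delta_mx e 0 : 'M_1) 0 0 by rewrite -colE mxE.
rewrite -(Tgam e) mulmxA -W0 -mulmxA Dgam mulmxA Wtau -mulmxA D1d0 mulmx0.
by rewrite mxE.
Qed.

End Obstruction.

(** * Linear quotients give linear resolutions *)

Section LinearQuotients.

Variables (k : fieldType) (n : nat) (A : comNzRingType).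
Variable pi : {rmorphism {mpoly k[n]} -> A}.
Hypothesis pi_surj : forall a, exists p, a = pi p.
Hypothesis pi_homog : forall p d, pi p = 0 -> pi (pihomog mdeg d p) = 0.

Notation gr := (img_grading pi).

(** The ideals that are allowed to occur as colon ideals. *)
Variable colons : (A -> Prop) -> Prop.

(** The rows of the matrix have linear entries, and the multipliers that bring a
    row into the span of the rows above it form an ideal satisfying [colons]. *)
Inductive linear_quotients a : forall c, 'M[A]_(c, a) -> Prop :=
| LinearQuotientsNil : @linear_quotients a 0 0
| LinearQuotientsCons c (N : 'M[A]_(c, a)) (x : 'rV[A]_a) (P : A -> Prop) :
    linear_quotients N -> mx_gr pi 1 x -> colons P ->
    (forall r, P r <-> exists u : 'rV_c, r *: x = u *m N) ->
    linear_quotients (col_mx N x).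

Lemma linear_quotients_gr a c (N : 'M[A]_(c, a)) :
  linear_quotients N -> mx_gr pi 1 N.
Proof.
elim=> {c N} [[] //|c N x P _ grN grx _ _] i j.
by rewrite mxE; case: split => i'; [apply: grN | apply: grx].
Qed.

Lemma linear_quotients_row_mx0 a b c (N : 'M[A]_(c, a)) :
  linear_quotients N -> linear_quotients (row_mx N (0 : 'M_(c, b))).
Proof.
elim=> {c N} [|c N x P _ lqN grx FP PE].
  by rewrite [row_mx _ _]flatmx0; constructor.
have -> : row_mx (col_mx N x) 0 = col_mx (row_mx N 0) (row_mx x (0 : 'M_(_, b))).
  by rewrite -[in LHS](@col_mx0 _ c 1) -block_mxEh -block_mxEv.
apply: (@LinearQuotientsCons _ _ _ _ P) => // [i j|r].
  rewrite mxE; case: split => j'; first exact: grx.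
  by rewrite mxE; exists 0; rewrite dhomog0 raddf0.
rewrite PE; split=> -[u uE]; exists u.
  by rewrite scale_row_mx scaler0 uE mul_mx_row mulmx0.
by move: uE; rewrite scale_row_mx scaler0 mul_mx_row mulmx0 => /eq_row_mx[].
Qed.

Hypothesis colons_lq : forall P, colons P -> exists c (L : 'M[A]_(c, 1)),
  linear_quotients L /\ forall r, P r <-> exists u : 'rV_c, r%:M = u *m L.

(** Why the property passes to syzygies: order the relations between the rows
    by the last row that occurs in them. The possible coefficients of the last row
    [x] form its colon ideal, which is itself generated by linear forms with linear
    quotients. Lifting each of these generators [l] to a relation [row_mx q l], with
    [q] linear for degree reasons, adds one row with the same colon ideal as [l],
    since a relation without [x] is a relation between the previous rows. *)
Lemma linear_quotients_syzygies a c (N : 'M[A]_(c, a)) :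
  linear_quotients N ->
  exists b (K : 'M[A]_(b, c)), linear_quotients K /\
    forall u : 'rV_c, u *m N = 0 <-> exists w : 'rV_b, u = w *m K.
Proof.
elim=> {c N} [|c N x P lqN [b [K [lqK KE]]] grx FP PE].
  exists 0%N, 0; split=> [|u]; first by constructor.
  by split=> _; rewrite ?mulmx0 //; exists 0; rewrite mulmx0 [LHS]thinmx0.
have [s [L [lqL LE]]] := colons_lq FP.
suff [b' [K' [lqK' K'E]]] : exists b' (K' : 'M[A]_(b', c + 1)),
    linear_quotients K' /\ forall u : 'rV_(c + 1),
    (exists w : 'rV_b', u = w *m K') <->
    u *m col_mx N x = 0 /\ exists w : 'rV_s, rsubmx u = w *m L.
  exists b', K'; split=> // u; rewrite K'E; split=> [uN|[]//]; split=> //.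
  have [w wE] : exists w : 'rV_s, (rsubmx u 0 0)%:M = w *m L.
    apply/LE/PE; exists (- lsubmx u); apply/eqP; rewrite mulNmx -addr_eq0 addrC.
    by rewrite -mul_scalar_mx -mx11_scalar -mul_row_col hsubmxK uN.
  by exists w; rewrite -wE -mx11_scalar.
have Lin r : (exists u : 'rV_s, r%:M = u *m L) -> exists u : 'rV_c, r *: x = u *m N.
  by move=> /LE/PE.
(* The generators of the colon ideal of x are lifted one at a time. *)
elim: lqL Lin {LE} => {s L} [Lin|s L l Q lqL IH grl FQ QE Lin].
  exists b, (row_mx K 0); split; first exact: linear_quotients_row_mx0.
  move=> u; rewrite -{1 2}[u]hsubmxK mul_row_col; split.
    case=> w; rewrite mul_mx_row mulmx0 => /eq_row_mx[uE ->].
    rewrite mul0mx addr0; split; first by apply/KE; exists w.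
    by exists 0; rewrite mul0mx.
  case=> uN [w uw]; move: uN; rewrite uw mulmx0 mul0mx addr0 => /KE[w' ->].
  by exists w'; rewrite mul_mx_row mulmx0.
have [|b' [E [lqE EE]]] := IH.
  move=> r [u uE]; apply: Lin; exists (row_mx u 0).
  by rewrite mul_row_col mul0mx addr0.
have [q [grq qE]] : exists q, mx_gr pi 1 q /\ - (l 0 0 *: x) = q *m N.
  apply: (@gr_solve _ _ _ pi pi_surj pi_homog 1 c a 1 1).
  - move=> i j; have [p [hp pE]] := grl 0 0; have [p' [hp' p'E]] := grx i j.
    exists (- (p * p')); rewrite !mxE pE p'E rmorphN rmorphM; split=> //.
    by rewrite dhomogN; apply: (dhomogM hp hp').
  - exact: linear_quotients_gr lqN.
  - have [|w wE] := Lin (l 0 0); last by exists (- w); rewrite wE mulNmx.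
    by exists (row_mx 0 1%:M); rewrite mul_row_col mul0mx add0r mul1mx -mx11_scalar.
exists (b' + 1)%N, (col_mx E (row_mx q l)).
have qlN : row_mx q l *m col_mx N x = 0.
  by rewrite mul_row_col {1}[l]mx11_scalar mul_scalar_mx -qE addNr.
split.
  apply: (LinearQuotientsCons (P := Q)) => // [i j|r].
    by rewrite mxE; case: split => j'; [apply: grq | apply: grl].
  rewrite QE EE -scalemxAl qlN scaler0 scale_row_mx row_mxKr.
  by split=> [[u uE]|[_ //]]; split=> //; exists u.
move=> u; split.
  case=> w; rewrite -[w]hsubmxK mul_row_col => ->.
  have [|w1N [w2 w2E]] := (EE (lsubmx w *m E)).1; first by exists (lsubmx w).
  rewrite mulmxDl w1N -mulmxA qlN mulmx0 addr0; split=> //.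
  exists (row_mx w2 (rsubmx w)); rewrite mul_row_col -w2E linearD /=.
  by rewrite mul_mx_row row_mxKr.
case=> uN [w wE]; have [|w' w'E] := (EE (u - rsubmx w *m row_mx q l)).2.
  rewrite mulmxBl uN -mulmxA qlN mulmx0 subr0; split=> //.
  exists (lsubmx w); rewrite linearB /= mul_mx_row row_mxKr wE.
  by rewrite -{1}[w]hsubmxK mul_row_col addrK.
exists (row_mx w' (rsubmx w)); rewrite mul_row_col -w'E.
by rewrite subrK.
Qed.

Record stage := Stage {
  stage_cols : nat;
  stage_rows : nat;
  stage_mx : 'M[A]_(stage_rows, stage_cols);
  stage_lq : linear_quotients stage_mx
}.

Definition next_stage (st : stage) : stage :=
  let ex := linear_quotients_syzygies (stage_lq st) in
  let ex' := projT2 (cid ex) in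
  @Stage (stage_rows st) (projT1 (cid ex)) (projT1 (cid ex'))
    (proj1 (projT2 (cid ex'))).

Lemma next_stage_exact (st : stage) (u : 'rV_(stage_rows st)) :
  u *m stage_mx st = 0 <-> exists w, u = w *m stage_mx (next_stage st).
Proof. by rewrite /next_stage /=; case: cid => b /= ex; case: cid => K /= [_]; apply. Qed.

(** Iterating the passage to syzygies resolves the residue field. *)
Theorem linear_quotients_koszul c (L : 'M[A]_(c, 1)) :
    linear_quotients L ->
    (forall r, irrelevant_ideal gr r <-> exists u : 'rV_c, r%:M = u *m L) ->
  koszul gr.
Proof.
move=> lqL LE; pose st i := iter i next_stage (Stage lqL).
pose rk i := stage_cols (st i).
pose D i : 'M[A]_(rk i.+1, rk i) := stage_mx (st i).
pose aug : 'cV[A]_(rk 0%N) := 1%:M.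
have gr1 : gr 0 1 by exists 1; rewrite dhomog1 rmorph1.
unshelve refine (ex_intro _ (@GradedFreeResolution _ _ rk (fun i _ => i) D aug _ _ _ _ _) _).
- by move=> i p q; rewrite leqnSn subSnn; exact: (linear_quotients_gr (stage_lq (st i))).
- by move=> q; rewrite (ord1 q) mxE.
- exists 1%:M; rewrite mulmx1 mxE subrr; exists [::]; rewrite big_nil; split=> //.
- move=> u; rewrite /aug mulmx1 LE.
  have uE : (u 0 0)%:M = u := esym (mx11_scalar u).
  by split=> -[w wE]; exists w; rewrite -wE uE.
- by move=> i u; exact: next_stage_exact.
- by [].
Qed.

End LinearQuotients.

(** * Colon ideals of ideals generated by variables *)

Inductive ideal_span (R : comNzRingType) (P : R -> Prop) : R -> Prop :=
| IdealSpan0 : ideal_span P 0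
| IdealSpanD a g p : P g -> ideal_span P p -> ideal_span P (a * g + p).

Section IdealSpan.

Variable R : comNzRingType.
Implicit Types (P Q : R -> Prop) (p q : R).

Lemma ideal_span_add P p q :
  ideal_span P p -> ideal_span P q -> ideal_span P (p + q).
Proof.
by elim=> {p} [|a g p Pg _ IH] Iq; rewrite ?add0r // -addrA; constructor; auto.
Qed.

Lemma ideal_span_gen P g : P g -> ideal_span P g.
Proof.
by move=> Pg; have := IdealSpanD 1 Pg (IdealSpan0 P); rewrite mul1r addr0.
Qed.

Lemma ideal_span_mul P a p : ideal_span P p -> ideal_span P (a * p).
Proof.
elim=> {p} [|b g p Pg _ IH]; first by rewrite mulr0; constructor.
by rewrite mulrDr mulrA; constructor.
Qed.

Lemma ideal_span_opp P p : ideal_span P p -> ideal_span P (- p).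
Proof. by rewrite -mulN1r; apply: ideal_span_mul. Qed.

Lemma ideal_span_sum P (I : Type) (r : seq I) (B : pred I) (F : I -> R) :
  (forall i, B i -> ideal_span P (F i)) -> ideal_span P (\sum_(i <- r | B i) F i).
Proof.
move=> IF; elim/big_rec: _ => [|i x Bi Ix]; first by constructor.
by apply: ideal_span_add => //; apply: IF.
Qed.

Lemma ideal_span_sub P Q p :
  (forall g, P g -> ideal_span Q g) -> ideal_span P p -> ideal_span Q p.
Proof.
move=> PQ; elim=> {p} [|a g p Pg _ IH]; first by constructor.
by apply: ideal_span_add => //; apply: ideal_span_mul; apply: PQ.
Qed.

Lemma ideal_span_adjoin P P' z p :
    (forall g, P g -> P' g) -> P' z -> (forall g, P' g -> P g \/ g = z) ->
  ideal_span P' p <-> exists q, ideal_span P (p - q * z).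
Proof.
move=> PP' P'z P'P; split=> [|[q Iq]].
  elim=> {p} [|a g p /P'P Pg _ [q Iq]].
    by exists 0; rewrite mul0r subrr; constructor.
  case: Pg => [Pg|->]; last by exists (a + q); rewrite mulrDl opprD addrACA subrr add0r.
  by exists q; rewrite -addrA; apply: IdealSpanD.
rewrite -[p](subrK (q * z)); apply: ideal_span_add.
  by apply: ideal_span_sub Iq => g /PP'; apply: ideal_span_gen.
by apply/ideal_span_mul/ideal_span_gen.
Qed.

End IdealSpan.

Section FreeVariable.

Variables (k : fieldType) (n : nat) (i : 'I_n) (P : {mpoly k[n]} -> Prop).
Notation sigma := (zeroing (pred1 i)).
Hypothesis P_fixed : forall g, P g -> sigma g = g.

Lemma ideal_span_zeroing p : ideal_span P p -> ideal_span P (sigma p).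
Proof.
elim=> {p} [|a g p Pg _ IH]; first by rewrite rmorph0; constructor.
by rewrite rmorphD rmorphM /= (P_fixed Pg); constructor.
Qed.

Lemma ideal_span_divX p :
  ideal_span P p -> exists2 q, ideal_span P q & p = 'X_i * q + sigma p.
Proof.
elim=> {p} [|a g p Pg _ [q Iq pE]].
  by exists 0; rewrite ?rmorph0 ?mulr0 ?add0r //; constructor.
have [b aE] := zeroing_dvd i a; exists (b * g + q); first by constructor.
rewrite rmorphD rmorphM /= (P_fixed Pg) {1}aE {1}pE mulrDl mulrDr.
by rewrite -!addrA mulrA; congr (_ + _); rewrite addrCA.
Qed.

Lemma mpolyX_neq0 : 'X_i != 0 :> {mpoly k[n]}.
Proof.
apply/eqP => /(congr1 (fun p => p@_U_(i)%MM)).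
by rewrite mcoeffXU eqxx mcoeff0 => /eqP; rewrite oner_eq0.
Qed.

(** A variable that does not occur in the generators of an ideal is regular
    modulo this ideal. *)
Lemma ideal_span_regularX g : ideal_span P ('X_i * g) -> ideal_span P g.
Proof.
move=> /ideal_span_divX[q Iq]; rewrite rmorphM /= zeroingX /= eqxx mul0r addr0.
by move/(mulfI mpolyX_neq0) => ->.
Qed.

End FreeVariable.

Section ColonIdeals.

Variables (k : fieldType) (m : nat) (h : rel 'I_m).
Hypothesis h_sym : symmetric h.

Notation S := {mpoly k[m + m]}.
Notation x := (@bei_x k m).
Notation y := (@bei_y k m).
Notation f := (@bei_gen k m).
Implicit Types (X Y D : {set 'I_m}) (a b c : 'I_m).

(** The generators of the ideal of the edges inside [D], of the [x a] with
    [a \in X] and of the [y b] with [b \in Y]. *)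
Inductive edge_gens X Y D : S -> Prop :=
| EdgeGensX a of a \in X : edge_gens X Y D (x a)
| EdgeGensY b of b \in Y : edge_gens X Y D (y b)
| EdgeGensF a b of a \in D & b \in D & h a b : edge_gens X Y D (f a b).

Notation ideal X Y D := (ideal_span (edge_gens X Y D)).

Lemma bei_gen_sym a b : f a b = - f b a.
Proof. by rewrite /bei_gen opprB. Qed.

Lemma bei_gen_xy a b : x a * y b = x b * y a + f a b.
Proof. by rewrite /bei_gen addrCA subrr addr0. Qed.

Lemma ideal_mono X Y D X' Y' D' p : X \subset X' -> Y \subset Y' -> D \subset D' ->
  ideal X Y D p -> ideal X' Y' D' p.
Proof.
move=> /subsetP sX /subsetP sY /subsetP sD.
apply: ideal_span_sub => g Pg; apply: ideal_span_gen; case: Pg => [a|b|a b] *.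
- by apply: EdgeGensX; apply: sX.
- by apply: EdgeGensY; apply: sY.
- by apply: EdgeGensF => //; apply: sD.
Qed.

Lemma ideal_x X Y D a p : a \in X -> ideal X Y D (x a * p).
Proof.
by move=> aX; rewrite mulrC; apply/ideal_span_mul/ideal_span_gen/EdgeGensX.
Qed.

Lemma ideal_y X Y D a p : a \in Y -> ideal X Y D (y a * p).
Proof.
by move=> aX; rewrite mulrC; apply/ideal_span_mul/ideal_span_gen/EdgeGensY.
Qed.

Lemma zeroing_x (j : 'I_(m + m)) a : lshift m a != j -> zeroing (pred1 j) (x a) = x a.
Proof. by move=> /negbTE aj; rewrite zeroingX /= aj. Qed.

Lemma zeroing_y (j : 'I_(m + m)) a : rshift m a != j -> zeroing (pred1 j) (y a) = y a.
Proof. by move=> /negbTE aj; rewrite zeroingX /= aj. Qed.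

Lemma edge_gens_fixed_x X Y D a g : a \notin X -> a \notin D ->
  edge_gens X Y D g -> zeroing (pred1 (lshift m a)) g = g.
Proof.
move=> aX aD [b bX|b bY|b c bD cD _].
- by rewrite zeroing_x // eq_lshift; apply: contraNneq aX => <-.
- by rewrite zeroing_y // eq_rlshift.
have ba : b != a by apply: contraNneq aD => <-.
have ca : c != a by apply: contraNneq aD => <-.
by rewrite rmorphB !rmorphM /= !zeroing_x ?zeroing_y ?eq_lshift ?eq_rlshift.
Qed.

Lemma edge_gens_fixed_y X Y D a g : a \notin Y -> a \notin D ->
  edge_gens X Y D g -> zeroing (pred1 (rshift m a)) g = g.
Proof.
move=> aY aD [b bX|b bY|b c bD cD _].
- by rewrite zeroing_x // eq_lrshift.
- by rewrite zeroing_y // eq_rshift; apply: contraNneq aY => <-.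
have ba : b != a by apply: contraNneq aD => <-.
have ca : c != a by apply: contraNneq aD => <-.
by rewrite rmorphB !rmorphM /= !zeroing_x ?zeroing_y ?eq_rshift ?eq_lrshift.
Qed.

(** Isolates the edges at the vertex [a]. *)
Lemma ideal_split_vertex X Y D a p : a \in D -> ideal X Y D p ->
  exists c : 'I_m -> S, exists2 w, ideal X Y (D :\ a) w &
    p = \sum_(b in D :\ a | h b a) c b * f b a + w.
Proof.
move=> aD; elim=> {p} [|r g p Pg _ [c [w Iw pE]]].
  exists (fun => 0), 0; first by constructor.
  by rewrite big1 ?addr0 // => b _; rewrite mul0r.
have upd b (s : S) : b \in D :\ a -> h b a ->
    exists c' : 'I_m -> S, exists2 w', ideal X Y (D :\ a) w' &
    s * f b a + p = \sum_(b in D :\ a | h b a) c' b * f b a + w'.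
  move=> bD hba; exists (fun b' => if b' == b then s + c b' else c b'), w => //.
  rewrite pE (bigD1 b) ?bD //= [in RHS](bigD1 b) ?bD //= eqxx mulrDl -!addrA.
  congr (_ + (_ + (_ + _))); apply: eq_bigr => b' /andP[_ /negbTE ->] //.
have old : ideal X Y (D :\ a) g -> exists c' : 'I_m -> S,
    exists2 w', ideal X Y (D :\ a) w' &
    r * g + p = \sum_(b in D :\ a | h b a) c' b * f b a + w'.
  move=> Ig; exists c, (r * g + w); last by rewrite pE addrCA.
  by apply: ideal_span_add => //; apply: ideal_span_mul.
case: Pg old upd => [b bX|b bY|b1 b2 b1D b2D h12] old upd.
- by apply: old; apply/ideal_span_gen/EdgeGensX.
- by apply: old; apply/ideal_span_gen/EdgeGensY.
have [E1|n1] := eqVneq b1 a.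
  have [E2|n2] := eqVneq b2 a.
    by apply: old; rewrite E1 E2 /bei_gen subrr; constructor.
  rewrite E1 bei_gen_sym mulrN -mulNr; apply: upd; first by rewrite !inE n2.
  by rewrite h_sym -E1.
have [E2|n2] := eqVneq b2 a.
  by rewrite E2; apply: upd; rewrite ?inE ?n1 // -E2.
by apply: old; apply: ideal_span_gen; apply: EdgeGensF; rewrite // !inE ?n1 ?n2.
Qed.

Variable pos : 'I_m -> nat.
Hypothesis pos_inj : injective pos.
Hypothesis h_interval : forall a b c,
  (pos a < pos b)%N -> (pos b < pos c)%N -> h a c -> h a b /\ h b c.

(** Induction on [D]. Write [x a * g] as a combination of the edges [f b a] and of
    the ideal of [D :\ a], and separate the terms divisible by [x a]: what remains to
    be shown is that [\sum r b * y b] lies in the ideal of [D :\ a], knowing that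
    [\sum r b * x b] does (sums over the neighbours [b] of [a]). The last vertex [a']
    of [D :\ a] is adjacent to all these [b], because the graph is an interval graph
    for the order [pos]; hence multiplying the first sum by [x a'] gives [y a'] times
    the second one modulo edges, and [x a'] is regular by induction. *)
Lemma last_x_regular X Y D a g : a \in D -> (forall b, b \in D -> (pos b <= pos a)%N) ->
    [disjoint X & D] -> [disjoint Y & D] ->
  ideal X Y D (x a * g) -> ideal X Y D g.
Proof.
have [N] := ubnP #|D|; elim: N D a g => // N IH D a g ltD aD maxa dX dY.
pose D' := D :\ a; have sD' : D' \subset D by apply: subD1set.
have aX : a \notin X by apply: contraTN aD => aX; rewrite (disjointFr dX).
have aY : a \notin Y by apply: contraTN aD => aY; rewrite (disjointFr dY).
have aD' : a \notin D' by rewrite !inE eqxx.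
move=> /(ideal_split_vertex aD)[c [w Iw]]; rewrite -/D' in Iw * => gE.
pose sigma := zeroing (pred1 (lshift m a) : pred 'I_(m + m)) : S -> S.
have fix_x g' := @edge_gens_fixed_x X Y D' a g' aX aD'.
have fix_y g' := @edge_gens_fixed_y X Y D' a g' aY aD'.
have [w' Iw' wE] := ideal_span_divX fix_x Iw.
have Isw := ideal_span_zeroing fix_x Iw.
have /choice[c' cE] b := zeroing_dvd (lshift m a) (c b).
have sx : sigma (x a) = 0 by rewrite /sigma zeroingX /= eqxx.
have sf b : b \in D' -> sigma (f b a) = x b * y a.
  rewrite inE in_set1 => /andP[ba _]; rewrite /sigma rmorphB !rmorphM /=.
  by rewrite -/sigma sx mul0r subr0 /sigma zeroing_x ?zeroing_y ?eq_lshift ?eq_rlshift.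
pose r b := sigma (c b).
have r0 : \sum_(b in D' | h b a) r b * (x b * y a) + sigma w = 0.
  have := congr1 sigma gE; rewrite {1}/sigma rmorphM /= -/sigma sx mul0r.
  rewrite /sigma rmorphD rmorph_sum /= -/sigma => E; rewrite [RHS]E; congr (_ + _).
  by apply: eq_bigr => b /andP[bD' _]; rewrite -sf // /r /sigma rmorphM.
have {gE} -> : g = \sum_(b in D' | h b a) c' b * f b a
                 - \sum_(b in D' | h b a) r b * y b + w'.
  apply: (mulfI (mpolyX_neq0 k (lshift m a))); rewrite -/(x a) gE wE.
  have -> : \sum_(b in D' | h b a) c b * f b a =
      x a * (\sum_(b in D' | h b a) c' b * f b a - \sum_(b in D' | h b a) r b * y b)
      + \sum_(b in D' | h b a) r b * (x b * y a).
    rewrite -sumrB mulr_sumr -big_split; apply: eq_bigr => b _ /=.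
    by rewrite {1}cE -/sigma -/(r b) -/(x a) /bei_gen; ring.
  by rewrite -/(sigma w) -addrA [X in _ + X]addrCA r0 addr0 -mulrDr.
apply: ideal_span_add; last exact: ideal_mono Iw'.
apply: ideal_span_add.
  apply: ideal_span_sum => b /andP[bD' hba]; apply/ideal_span_mul/ideal_span_gen.
  by apply: EdgeGensF => //; apply: (subsetP sD').
apply: ideal_span_opp.
suff : ideal X Y D' (\sum_(b in D' | h b a) r b * y b) by apply: ideal_mono.
have [/existsP[b0 /andP[b0D' hb0a]]|] := boolP [exists b in D', h b a]; last first.
  rewrite negb_exists => /forallP none; rewrite big1 => [|b /andP[bD' hba]].
    by constructor.
  by have := none b; rewrite bD' hba.
pose a' := [arg max_(b > b0 in D') pos b].
have [a'D' maxa'] : a' \in D' /\ forall b, b \in D' -> (pos b <= pos a')%N.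
  by rewrite /a'; case: arg_maxnP.
have lt_a b : b \in D' -> (pos b < pos a)%N.
  rewrite inE in_set1 => /andP[ba bD]; rewrite ltn_neqAle maxa // andbT.
  by rewrite (inj_eq pos_inj).
have adj b : b \in D' -> h b a -> b = a' \/ h b a' /\ h a' a.
  move=> bD' hba; have [->|ne] := eqVneq b a'; [by left | right].
  apply: (@h_interval b a' a) => //; last exact: lt_a.
  by rewrite ltn_neqAle maxa' // andbT (inj_eq pos_inj).
apply: (IH D' a') => //.
- by move: ltD; rewrite (cardsD1 a D) aD.
- by apply: disjointWr dX.
- by apply: disjointWr dY.
rewrite mulr_sumr.
suff Irx : ideal X Y D' (\sum_(b in D' | h b a) r b * x b).
  have -> : \sum_(b in D' | h b a) x a' * (r b * y b) =
      y a' * (\sum_(b in D' | h b a) r b * x b) -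
      \sum_(b in D' | h b a) r b * f b a'.
    by rewrite mulr_sumr -sumrB; apply: eq_bigr => b _; rewrite /bei_gen; ring.
  apply: ideal_span_add; first exact: ideal_span_mul.
  apply/ideal_span_opp/ideal_span_sum => b /andP[bD' hba].
  apply: ideal_span_mul; have [->|[hba' _]] := adj b bD' hba.
    by rewrite /bei_gen subrr; constructor.
  by apply/ideal_span_gen/EdgeGensF.
apply: (ideal_span_regularX fix_y).
rewrite -/(y a); have -> : y a * (\sum_(b in D' | h b a) r b * x b) = - sigma w.
  apply/eqP; rewrite -addr_eq0 -[X in _ == X]r0 mulr_sumr; apply/eqP.
  by congr (_ + _); apply: eq_bigr => b _; ring.
exact: ideal_span_opp.
Qed.



Definition up_closed X := forall a b, a \in X -> (pos a < pos b)%N -> b \in X.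

Definition nbhd a := [set b | h b a].

Lemma nbhd_up_closed X c : up_closed X -> c \in X -> up_closed (X :|: nbhd c).
Proof.
move=> upX cX a b; rewrite !inE => /orP[aX lt_ab|hac lt_ab].
  by rewrite (upX a).
have [//|bX] := boolP (b \in X).
have lt_bc : (pos b < pos c)%N.
  rewrite ltnNge leq_eqVlt (inj_eq pos_inj); apply/norP; split.
    by apply: contraNneq bX => <-.
  by apply: contra bX; exact: upX.
by have [_ ->] := h_interval lt_ab lt_bc hac.
Qed.

(** [y c] kills the [x a] with [a] adjacent to [c], as [y c * x a] equals [x c * y a]
    up to an edge. Once these are added, [y c] occurs in no generator any more. *)
Lemma colon_y X Y c g : Y \subset X -> c \in X -> c \notin Y ->
  ideal X Y setT (y c * g) <-> ideal (X :|: nbhd c) Y setT g.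
Proof.
move=> sYX cX cY; split.
  have regen p : ideal (X :|: nbhd c) Y setT p -> ideal (X :|: nbhd c) Y (~: [set c]) p.
    apply: ideal_span_sub => q [a aX|b bY|a b _ _ hab].
    - by apply/ideal_span_gen/EdgeGensX.
    - by apply/ideal_span_gen/EdgeGensY.
    have cU : c \in X :|: nbhd c by rewrite inE cX.
    have [ac|nac] := eqVneq a c.
      have bU : b \in X :|: nbhd c by rewrite !inE h_sym -ac hab orbT.
      apply: ideal_span_add; first by rewrite ac; apply: ideal_x.
      by apply: ideal_span_opp; apply: ideal_x.
    have [bc|nbc] := eqVneq b c.
      have aU : a \in X :|: nbhd c by rewrite !inE -bc hab orbT.
      apply: ideal_span_add; first exact: ideal_x.
      by apply: ideal_span_opp; rewrite bc; apply: ideal_x.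
    by apply: ideal_span_gen; apply: EdgeGensF; rewrite ?inE.
  move=> /(ideal_mono (subsetUl X (nbhd c)) (subxx _) (subxx _))/regen Ig.
  apply: (ideal_mono (subxx _) (subxx _) (subsetT (~: [set c]))).
  apply: ideal_span_regularX Ig => q; apply: edge_gens_fixed_y cY _.
  by rewrite !inE eqxx.
elim=> {g} [|a g p Pg _ IH]; first by rewrite mulr0; constructor.
rewrite mulrDr; apply: ideal_span_add => //; rewrite mulrCA.
apply: ideal_span_mul; case: Pg => [b|b bY|b b' _ _ hb].
- rewrite inE => /orP[bX|]; first by rewrite mulrC; apply: ideal_x.
  rewrite inE => hbc; rewrite mulrC bei_gen_xy; apply: ideal_span_add.
    exact: ideal_x.
  by apply: ideal_span_gen; apply: EdgeGensF; rewrite ?inE.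
- by rewrite mulrC; apply: ideal_y.
- by apply/ideal_span_mul/ideal_span_gen; apply: EdgeGensF; rewrite ?inE.
Qed.

(** [x a] kills the [y b] with [b \in X] adjacent to [a]. Once these are added, the
    edges that meet [X] become redundant: if [f b c] is an edge with [c \in X] and
    [b \notin X], then [b = a] or [b] comes before [a], so that [c] is adjacent to [a]
    and both [x c] and [y c] are in the ideal. What is left is the situation of
    [last_x_regular]. *)
Lemma colon_x X a g : up_closed X -> a \notin X ->
    (forall b, b \notin X -> (pos b <= pos a)%N) ->
  ideal X set0 setT (x a * g) <-> ideal X (nbhd a :&: X) setT g.
Proof.
move=> upX aX maxa; pose Y := nbhd a :&: X; split.
  have regen p : ideal X Y setT p -> ideal X Y (~: X) p.
    apply: ideal_span_sub => q [b bX|b bY|].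
    - by apply/ideal_span_gen/EdgeGensX.
    - by apply/ideal_span_gen/EdgeGensY.
    have half b c : h b c -> c \in X -> ideal X Y (~: X) (f b c).
      move=> hbc cX; apply: ideal_span_add; last first.
        by apply: ideal_span_opp; apply: ideal_x.
      have [bX|bX] := boolP (b \in X); first exact: ideal_x.
      rewrite mulrC; apply: ideal_y; rewrite !inE cX andbT h_sym.
      have [<- //|nba] := eqVneq b a.
      have lt_ba : (pos b < pos a)%N.
        by rewrite ltn_neqAle maxa // andbT (inj_eq pos_inj).
      have lt_ac : (pos a < pos c)%N.
        rewrite ltnNge leq_eqVlt (inj_eq pos_inj); apply/norP; split.
          by apply: contraNneq aX => <-.
        by apply: contra aX; exact: upX.
      by have [] := h_interval lt_ba lt_ac hbc.
    move=> b c _ _ hbc; have [cX|cX] := boolP (c \in X); first exact: half.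
    have [bX|bX] := boolP (b \in X).
      by rewrite bei_gen_sym; apply/ideal_span_opp/half => //; rewrite h_sym.
    by apply: ideal_span_gen; apply: EdgeGensF; rewrite ?inE.
  move=> /(ideal_mono (subxx _) (sub0set Y) (subxx _))/regen Ig.
  apply: (ideal_mono (subxx _) (subxx _) (subsetT (~: X))).
  apply: last_x_regular Ig; rewrite ?inE //.
  - by move=> b; rewrite inE; exact: maxa.
  - by rewrite -setI_eq0 setICr.
  - by rewrite -setI_eq0 -setIA setICr setI0.
elim=> {g} [|r g p Pg _ IH]; first by rewrite mulr0; constructor.
rewrite mulrDr; apply: ideal_span_add => //; rewrite mulrCA.
apply: ideal_span_mul; case: Pg => [b bX|b|b b' _ _ hb].
- by rewrite mulrC; apply: ideal_x.
- rewrite !inE h_sym => /andP[hab bX]; rewrite bei_gen_xy; apply: ideal_span_add.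
    exact: ideal_x.
  by apply: ideal_span_gen; apply: EdgeGensF; rewrite ?inE.
- by apply/ideal_span_mul/ideal_span_gen; apply: EdgeGensF; rewrite ?inE.
Qed.

End ColonIdeals.

Section Quotient.

Variables (k : fieldType) (m : nat) (h : rel 'I_m).
Notation S := {mpoly k[m + m]}.

Definition bei_pi : {rmorphism S -> bei_quotient k h} :=
  (\pi_{ideal_quot (binomial_edge_ideal (k := k) h)})%qT.

Lemma bei_pi_surj a : exists p, a = bei_pi p.
Proof. by exists (repr a); rewrite [RHS]reprK. Qed.

Lemma bei_pi_eq0 p : bei_pi p = 0 <-> ideal_span (edge_gens h set0 set0 setT) p.
Proof.
have -> : (bei_pi p = 0) <-> (p \in binomial_edge_ideal (k := k) h).
  rewrite -[p in X in _ <-> X]subr0 Quotient.idealrBE.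
  by split=> [E|/eqP E]; [apply/eqP; rewrite [LHS]E [RHS]raddf0|rewrite [LHS]E [LHS]raddf0].
split.
  move/asboolP => [c ->]; apply: ideal_span_sum => i _; apply: ideal_span_sum => j hij.
  by apply/ideal_span_mul/ideal_span_gen; apply: EdgeGensF; rewrite ?inE.
elim=> {p} [|a g p Pg _ IH]; first exact: idealr0.
apply: rpredD => //; apply: idealMr; case: Pg => [b|b|i j _ _ hij]; rewrite ?inE //.
apply/asboolP; exists (fun i' j' => ((i' == i) && (j' == j))%:R).
rewrite (bigD1 i) //= (bigD1 j) //= !eqxx mul1r !big1 ?addr0 // => [i' /negbTE ni|j'].
  by rewrite big1 // => j' _; rewrite ni mul0r.
by move=> /andP[_ /negbTE ->]; rewrite andbF mul0r.
Qed.

Lemma bei_gen_homog (i j : 'I_m) : bei_gen k i j \is 2.-homog.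
Proof.
by apply: rpredB; rewrite -[2%N]/(1 + 1)%N; apply: dhomogM;
  rewrite dhomogX /= mdeg1.
Qed.

Lemma bei_pi_homog p d : bei_pi p = 0 -> bei_pi (pihomog mdeg d p) = 0.
Proof.
rewrite !bei_pi_eq0; elim=> {p} [|a g p Pg _ IH]; first by rewrite raddf0; constructor.
rewrite raddfD /=; apply: ideal_span_add => //.
case: Pg => [b|b|i j _ _ hij]; rewrite ?inE //.
have [lt_d|] := ltnP d 2.
  by rewrite (pihomogM_lt _ lt_d (bei_gen_homog _ _)); constructor.
move=> /subnK <-; rewrite (pihomogM _ _ (bei_gen_homog _ _)).
by apply/ideal_span_mul/ideal_span_gen; apply: EdgeGensF; rewrite ?inE.
Qed.

End Quotient.

(** * The Koszul filtration given by an interval labelling *)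

Section KoszulFiltration.

Variables (k : fieldType) (m : nat) (h : rel 'I_m).
Hypothesis h_sym : symmetric h.
Variable pos : 'I_m -> nat.
Hypothesis pos_inj : injective pos.
Hypothesis h_interval : forall a b c,
  (pos a < pos b)%N -> (pos b < pos c)%N -> h a c -> h a b /\ h b c.

Notation S := {mpoly k[m + m]}.
Notation pi := (bei_pi k h).
Notation gr := (img_grading pi).
Notation ideal X Y := (ideal_span (edge_gens h X Y setT)).
Implicit Types (X Y : {set 'I_m}) (r : bei_quotient k h) (p : S).

Definition variable_ideal X Y r := exists2 p, r = pi p & ideal X Y p.

Lemma variable_idealP X Y p : variable_ideal X Y (pi p) <-> ideal X Y p.
Proof.
split=> [[q pq Iq]|Ip]; last by exists p.
rewrite -[p](subrK q); apply: ideal_span_add => //.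
apply: (ideal_mono (sub0set _) (sub0set _) (subxx _)); apply/bei_pi_eq0.
by rewrite raddfB /= pq subrr.
Qed.

(** The family of the ideals [(x a, y b)_(a \in X, b \in Y)] with [X] closed upwards
    and [Y] contained in [X] is stable under the colon operations needed to build its
    members one variable at a time, by [colon_y] and [colon_x]. *)
Definition filtration (P : bei_quotient k h -> Prop) :=
  exists X Y, [/\ up_closed pos X, Y \subset X & forall r, P r <-> variable_ideal X Y r].


Lemma linear_quotients_extend X Y X' Y' X1 Y1 (z : S) c (L : 'M_(c, 1)) :
    z \is 1.-homog ->
    (forall p, ideal X' Y' p <-> exists q, ideal X Y (p - q * z)) ->
    up_closed pos X1 -> Y1 \subset X1 ->
    (forall p, ideal X Y (z * p) <-> ideal X1 Y1 p) ->
    linear_quotients pi filtration L ->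
    (forall r, variable_ideal X Y r <-> exists u : 'rV_c, r%:M = u *m L) ->
  exists c' (L' : 'M_(c', 1)), linear_quotients pi filtration L' /\
    forall r, variable_ideal X' Y' r <-> exists u : 'rV_c', r%:M = u *m L'.
Proof.
move=> hz extE up1 sub1 colon lqL LE; exists (c + 1)%N, (col_mx L (pi z)%:M); split.
  apply: (@LinearQuotientsCons _ _ _ _ _ _ _ _ _ (variable_ideal X1 Y1)) => //.
  - by move=> i j; rewrite !ord1 mxE eqxx; exists z.
  - by exists X1, Y1.
  move=> r; rewrite scale_scalar_mx -LE; have [p ->] := bei_pi_surj r.
  by rewrite -rmorphM !variable_idealP mulrC colon.
move=> r; have [p ->] := bei_pi_surj r; rewrite variable_idealP extE; split.
  case=> q /variable_idealP/LE[u uE]; exists (row_mx u (pi q)%:M).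
  rewrite mul_row_col -uE -scalar_mxM -rmorphM -raddfD /= -rmorphD.
  by rewrite subrK.
case=> u uE; have [q qE] := bei_pi_surj (rsubmx u 0 0).
exists q; apply/variable_idealP/LE; exists (lsubmx u).
move: uE; rewrite -{1}[u]hsubmxK mul_row_col => /eqP; rewrite -subr_eq => /eqP <-.
rewrite [rsubmx u]mx11_scalar qE -scalar_mxM -rmorphM.
by rewrite -raddfB /= -raddfB.
Qed.

(** The variables [y c] are removed first, then the [x a] starting with the smallest
    [a]: the ideals stay in the filtration. *)
Lemma filtration_linear_quotients P : filtration P ->
  exists c (L : 'M_(c, 1)), linear_quotients pi filtration L /\
    forall r, P r <-> exists u : 'rV_c, r%:M = u *m L.
Proof.
case=> X [Y [upX sYX PE]].
suff [c [L [lqL LE]]] : exists c (L : 'M_(c, 1)), linear_quotients pi filtration L /\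
    forall r, variable_ideal X Y r <-> exists u : 'rV_c, r%:M = u *m L.
  by exists c, L; split=> // r; rewrite PE LE.
have [N] := ubnP (#|X| + #|Y|)%N; elim: N X Y upX sYX {P PE} => // N IH X Y upX sYX ltN.
have [Y0|[c cY]] := set_0Vmem Y; last first.
  have cX := subsetP sYX c cY; pose Y1 := Y :\ c.
  have sY1 : Y1 \subset X by apply: subset_trans sYX; apply: subD1set.
  have cY1 : c \notin Y1 by rewrite !inE eqxx.
  have [|L0 [L [lqL LE]]] := IH X Y1 upX sY1.
    by rewrite (cardsD1 c Y) cY addnCA in ltN.
  apply: (@linear_quotients_extend X Y1 X Y (X :|: nbhd h c) Y1 (bei_y k c) _ L) => //.
  - by rewrite dhomogX /= mdeg1.
  - move=> p; apply: ideal_span_adjoin => [g [b bX|b|b b' *]||g [b bX|b bY|b b' *]].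
    + exact: EdgeGensX.
    + by rewrite inE => /andP[_ bY]; apply: EdgeGensY.
    + exact: EdgeGensF.
    + exact: EdgeGensY.
    + by left; apply: EdgeGensX.
    + have [->|nbc] := eqVneq b c; first by right.
      by left; apply: EdgeGensY; rewrite !inE nbc.
    + by left; apply: EdgeGensF.
  - exact: nbhd_up_closed.
  - by apply: subset_trans sY1 _; apply: subsetUl.
  - by move=> p; apply: colon_y.
rewrite {}Y0 in sYX ltN *; have [X0|[a0 a0X]] := set_0Vmem X.
  exists 0%N, 0; split; first by constructor.
  move=> r; have [p ->] := bei_pi_surj r; rewrite variable_idealP X0 -bei_pi_eq0.
  split=> [->|[u]]; first by exists 0; rewrite mulmx0 raddf0.
  by rewrite mulmx0 => /matrixP/(_ 0 0); rewrite !mxE eqxx.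
pose a := [arg min_(b < a0 in X) pos b].
have [aX mina] : a \in X /\ forall b, b \in X -> (pos a <= pos b)%N.
  by rewrite /a; case: arg_minnP.
pose X1 := X :\ a; have aX1 : a \notin X1 by rewrite !inE eqxx.
have upX1 : up_closed pos X1.
  move=> b c; rewrite !inE => /andP[nba bX] lt_bc; rewrite (upX b) // andbT.
  apply: contraTneq lt_bc => ->; rewrite -leqNgt; exact: mina.
have maxa b : b \notin X1 -> (pos b <= pos a)%N.
  rewrite !inE negb_and negbK => /orP[/eqP -> //|bX]; rewrite leqNgt.
  by apply: contra bX; apply: upX.
have [|L0 [L [lqL LE]]] := IH X1 set0 upX1 (sub0set _).
  by rewrite (cardsD1 a X) aX in ltN.
apply: (@linear_quotients_extend X1 set0 X set0 X1 (nbhd h a :&: X1) (bei_x k a) _ L) => //.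
- by rewrite dhomogX /= mdeg1.
- move=> p; apply: ideal_span_adjoin => [g [b|b bY|b b' *]||g [b bX|b bY|b b' *]].
  + by rewrite inE => /andP[_ bX]; apply: EdgeGensX.
  + exact: EdgeGensY.
  + exact: EdgeGensF.
  + exact: EdgeGensX.
  + have [->|nba] := eqVneq b a; first by right.
    by left; apply: EdgeGensX; rewrite !inE nba.
  + by left; apply: EdgeGensY.
  + by left; apply: EdgeGensF.
- exact: subsetIr.
- by move=> p; apply: (@colon_x k m h h_sym pos pos_inj h_interval X1 a p).
Qed.

Lemma irrelevant_idealP r :
  irrelevant_ideal gr r <-> variable_ideal setT setT r.
Proof.
split.
  case=> s [sP ->]; rewrite big_seq; elim/big_rec: _ => [|x z xs [p -> Ip]].
    by exists 0; rewrite ?raddf0 //; constructor.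
  have [d [q [hq ->]]] := sP x xs; exists (q + p); first by rewrite raddfD.
  apply: ideal_span_add => //; rewrite [q]mpolyE big_seq; apply: ideal_span_sum => M M_q.
  have /dhomogP/(_ M M_q)/= dM := hq.
  have [i Mi] : exists i, M i != 0%N.
    apply/existsP; apply: contraTT isT => /existsPn M0.
    have : mdeg M = 0%N by rewrite mdegE big1 // => i _; apply/eqP; rewrite -[_ == _]negbK M0.
    by rewrite dM.
  have -> : 'X_[M] = 'X_[M - U_(i)] * 'X_i :> S.
    rewrite -mpolyXD submK //; apply/mnm_lepP => j; rewrite mnm1E.
    by case: eqP => // <-; rewrite lt0n.
  rewrite -mul_mpolyC; apply/ideal_span_mul/ideal_span_mul/ideal_span_gen.
  by rewrite -(splitK i); case: split => j /=; [apply: EdgeGensX | apply: EdgeGensY];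
    rewrite inE.
case=> p -> Ip; have irrD a b : irrelevant_ideal gr a -> irrelevant_ideal gr b ->
    irrelevant_ideal gr (a + b).
  move=> [s [sP ->]] [t [tP ->]]; exists (s ++ t); rewrite big_cat; split=> // z.
  by rewrite mem_cat => /orP[/sP|/tP].
have irr0 : irrelevant_ideal gr 0 by exists [::]; rewrite big_nil.
elim: Ip => {p} [|q g p Pg _ IH]; first by rewrite raddf0.
have piD u v : pi (u + v) = pi u + pi v := raddfD _ u v.
rewrite piD; refine (irrD _ _ _ IH).
suff var g' : g' \is 1.-homog -> irrelevant_ideal gr (pi (q * g')).
  case: Pg => [b _|b _|b b' _ _ hb]; try by apply: var; rewrite dhomogX /= mdeg1.
  rewrite rmorphM (_ : pi (bei_gen k b b') = 0) ?mulr0 //.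
  by apply/bei_pi_eq0/ideal_span_gen; apply: EdgeGensF; rewrite ?inE.
move=> hg; rewrite [q](pihomog_partitionE (mf := mdeg) (leqnn _)) mulr_suml raddf_sum /=.
apply: (big_ind (irrelevant_ideal gr)) => [||i _]; [exact: irr0|exact: irrD|]; apply: (@irrelevant_gr _ _ _ _ i).
by exists (pihomog mdeg i q * g'); split=> //; rewrite -addn1; apply: dhomogM; rewrite ?pihomogP.
Qed.

Theorem interval_koszul : koszul (@bei_grading k m h).
Proof.
have [|c [L [lqL LE]]] := @filtration_linear_quotients (irrelevant_ideal gr).
  exists setT, setT; split; [by move=> ? ? ? _; rewrite inE | exact: subxx |].
  exact: irrelevant_idealP.
exact: (linear_quotients_koszul (bei_pi_surj (h := h)) (bei_pi_homog (h := h))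
  filtration_linear_quotients lqL LE).
Qed.

End KoszulFiltration.

(** * Koszul graphs have no induced claw and no induced long cycle *)

Section EdgeIdealObstruction.

Variables (k : fieldType) (m : nat) (h : rel 'I_m).
Hypotheses (h_sym : symmetric h) (h_irr : irreflexive h).

Notation S := {mpoly k[m + m]}.
Notation x := (@bei_x k m).
Notation y := (@bei_y k m).
Notation f := (@bei_gen k m).

Lemma edge_obstruction (Z : pred 'I_(m + m)) r s (v : 'I_s -> 'I_(m + m))
    (phi : 'M[S]_(r, s)) d (a : 'rV[S]_r) :
    injective v -> (forall l, Z (v l)) ->
    mx_homog 1 phi -> map_mx (zeroing Z) phi = phi ->
    (forall e, exists i j, h i j /\ \sum_l phi e l * 'X_(v l) = f i j) ->
    (forall i j, h i j -> zeroing Z (f i j) = 0) ->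
    (forall i j, h i j -> exists c : 'I_r -> S,
      forall l, linear_part Z v l (f i j) = \sum_e phi e l * c e) ->
    (forall (c : 'I_r -> S) d', (d' < d)%N -> (forall e, c e \is d'.-homog) ->
      (forall l, \sum_e phi e l * c e = 0) -> forall e, c e = 0) ->
    (1 < d)%N -> mx_homog d a -> map_mx (zeroing Z) a = a -> a *m phi = 0 ->
  koszul (@bei_grading k m h) -> a = 0.
Proof.
move=> v_inj Zv hphi Zphi relP Zf lpf phi_free d1 ha Za aphi.
apply: (linear_part_obstruction (bei_pi_surj (h := h)) (bei_pi_homog (h := h))
  v_inj Zv hphi Zphi _ _ _ phi_free d1 ha Za aphi).
- move=> e; have [i [j [hij ->]]] := relP e.
  by apply/bei_pi_eq0/ideal_span_gen; apply: EdgeGensF; rewrite ?inE.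
- move=> p /bei_pi_eq0; elim=> {p} [|b g p Pg _ IH]; first by rewrite rmorph0.
  rewrite rmorphD rmorphM /= IH addr0.
  by case: Pg => [i|i|i j _ _ /Zf ->]; rewrite ?inE // mulr0.
move=> p /bei_pi_eq0; elim=> {p} [|b g p Pg _ [c cE]].
  by exists (fun=> 0) => l; rewrite raddf0 big1 // => e _; rewrite mulr0.
case: Pg => [i|i|i j _ _ hij]; rewrite ?inE //.
have [c' c'E] := lpf i j hij; exists (fun e => zeroing Z b * c' e + c e) => l.
rewrite raddfD /= cE.
have -> : linear_part Z v l (b * f i j) = zeroing Z b * linear_part Z v l (f i j).
  by rewrite /linear_part mderivM rmorphD !rmorphM /= (Zf i j hij) mulr0 add0r.
rewrite c'E mulr_sumr -big_split; apply: eq_bigr => e _ /=.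
by rewrite mulrDr mulrCA.
Qed.

Lemma mderivXU n (i j : 'I_n) : ('X_i : {mpoly k[n]})^`M(j) = (i == j)%:R.
Proof.
rewrite mderivX mnm1E; case: eqP => [->|_]; last by rewrite scale0r.
have -> : (U_(j) - U_(j) = 0)%MM by apply/mnmP => z; rewrite mnmBE subnn mnm0E.
by rewrite scale1r mpolyX0.
Qed.

Lemma mderiv_bei_x i j p :
  (f i j)^`M(lshift m p) = (i == p)%:R * y j - (j == p)%:R * y i.
Proof.
by rewrite /bei_gen mderivB !mderivM !mderivXU !eq_lshift !eq_rlshift !mulr0 !addr0.
Qed.

Lemma mderiv_bei_y i j p :
  (f i j)^`M(rshift m p) = (j == p)%:R * x i - (i == p)%:R * x j.
Proof.
rewrite /bei_gen mderivB !mderivM !mderivXU !eq_rshift !eq_lrshift !mul0r !add0r.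
by rewrite ![_ * (_ == _)%:R]mulrC.
Qed.

Lemma bei_x_homog i : x i \is 1.-homog. Proof. by rewrite dhomogX /= mdeg1. Qed.
Lemma bei_y_homog i : y i \is 1.-homog. Proof. by rewrite dhomogX /= mdeg1. Qed.

Lemma bei_gen_neq0 i j : i != j -> f i j != 0.
Proof.
move=> ij; apply/eqP => /(congr1 (fun p => p^`M(lshift m i))).
rewrite mderiv_bei_x eqxx eq_sym (negbTE ij) mul1r mul0r subr0 raddf0.
by move/eqP; rewrite (negbTE (mpolyX_neq0 _ _)).
Qed.

(** The linear variables are the two variables of the centre [v0], the coefficients
    are the polynomials in the variables of the leaves. The two entries of
    [a *m phi] are Laplace expansions of 3 x 3 determinants with a repeated
    row. *)
Section Claw.

Variables (v0 : 'I_m) (t : 'I_3 -> 'I_m).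
Hypotheses (t_inj : injective t) (hv : forall e, h v0 (t e)).
Hypothesis t_ind : forall e e', h (t e) (t e') = false.

Let leaf j := [exists e, t e == j].
Let Z (q : 'I_(m + m)) := match split q with inl j => ~~ leaf j | inr j => ~~ leaf j end.

Lemma claw_Zx j : Z (lshift m j) = ~~ leaf j.
Proof. by rewrite /Z (unsplitK (inl j)). Qed.
Lemma claw_Zy j : Z (rshift m j) = ~~ leaf j.
Proof. by rewrite /Z (unsplitK (inr j)). Qed.

Lemma claw_x j : zeroing Z (x j) = if leaf j then x j else 0.
Proof. by rewrite zeroingX claw_Zx; case: leaf. Qed.
Lemma claw_y j : zeroing Z (y j) = if leaf j then y j else 0.
Proof. by rewrite zeroingX claw_Zy; case: leaf. Qed.

Lemma leaf_t e : leaf (t e).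
Proof. by apply/existsP; exists e. Qed.

Lemma leaf_v0 : leaf v0 = false.
Proof. by apply/existsP => -[e /eqP te]; have := hv e; rewrite te h_irr. Qed.

Let v (l : 'I_2) := if l == ord0 then lshift m v0 else rshift m v0.
Let phi : 'M[S]_(3, 2) :=
  \matrix_(e, l) if l == ord0 then y (t e) else - x (t e).

Lemma claw_sum c l : \sum_e phi e l * c e =
  if l == ord0 then \sum_e y (t e) * c e else - \sum_e x (t e) * c e.
Proof.
case: ifP => l0; rewrite -?sumrN; apply: eq_bigr => e _; rewrite mxE l0 //.
by rewrite mulNr.
Qed.

Lemma claw_elim (c : 'I_3 -> S) : (forall l, \sum_e phi e l * c e = 0) ->
  forall e e' : 'I_3, e != e' -> exists2 l, (l != e) && (l != e') &
    c e * f (t e) (t l) + c e' * f (t e') (t l) = 0.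
Proof.
move=> c0 e e' ee'.
have /existsP[l /andP[le le']] : [exists l : 'I_3, (l != e) && (l != e')].
  apply: contraT; rewrite negb_exists => /forallP none.
  have : (#|'I_3| <= #|[set e; e']|)%N.
    by apply/subset_leq_card/subsetP => l _; move: (none l); rewrite negb_and !negbK !inE.
  by rewrite card_ord; have := cards2 e e'; case: (_ != _) => /= ->.
exists l; first by rewrite le.
have yc : \sum_e y (t e) * c e = 0 by have := c0 ord0; rewrite claw_sum eqxx.
have xc : \sum_e x (t e) * c e = 0.
  by have /eqP := c0 (lift ord0 ord0); rewrite claw_sum /= oppr_eq0 => /eqP.
have : \sum_e c e * f (t e) (t l) = 0.
  rewrite (_ : \sum_e _ = y (t l) * (\sum_e x (t e) * c e) - x (t l) * (\sum_e y (t e) * c e)).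
    by rewrite yc xc !mulr0 subrr.
  by rewrite !mulr_sumr -sumrB; apply: eq_bigr => e1 _; rewrite /bei_gen; ring.
rewrite (bigD1 e) //= (bigD1 e') /=; last by rewrite eq_sym.
rewrite big1 ?addr0 // => e1 /andP[ne ne'].
have -> : e1 = l.
  apply/eqP; apply: contraT => nl.
  have : (#|[set e; e'; l; e1]| <= #|'I_3|)%N by apply: max_card.
  rewrite card_ord -!setUA !cardsU1 cards1 !inE !negb_or ee'.
  by rewrite eq_sym le eq_sym ne eq_sym le' eq_sym ne' eq_sym nl.
by rewrite /bei_gen subrr mulr0.
Qed.

Let leaf_pair e : pred 'I_(m + m) := pred2 (lshift m (t e)) (rshift m (t e)).

(** By Cramer's rule, [c e] vanishes when the variables of any other leaf do; there
    are two of them. *)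
Lemma claw_free : forall (c : 'I_3 -> S) d', (d' < 2)%N -> (forall e, c e \is d'.-homog) ->
  (forall l, \sum_e phi e l * c e = 0) -> forall e, c e = 0.
Proof.
move=> c d' d2 hc c0 e.
apply: (@zeroing_eq0 _ _ _ (predC1 e) leaf_pair d' (c e)) => // [u w i _ _||u /= ue].
- move=> /orP[] /eqP -> /orP[] /eqP/esym/eqP; rewrite ?eq_lshift ?eq_rshift ?eq_lrshift ?eq_rlshift //;
    by move/eqP/t_inj.
- by rewrite cardC1 card_ord.
have [l /andP[lu le]] := claw_elim c0 ue.
move/(congr1 (zeroing (leaf_pair u))); rewrite rmorphD !rmorphM /= rmorph0.
have -> : zeroing (leaf_pair u) (f (t u) (t l)) = 0.
  by rewrite rmorphB !rmorphM /= !zeroingX /leaf_pair /= !eqxx ?orbT mul0r mulr0 subrr.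
have -> : zeroing (leaf_pair u) (f (t e) (t l)) = f (t e) (t l).
  rewrite rmorphB !rmorphM /= !zeroingX /leaf_pair /= !eq_lshift !eq_rshift !eq_lrshift !eq_rlshift.
  by rewrite !(inj_eq t_inj) (negbTE lu) eq_sym (negbTE ue).
rewrite mulr0 add0r => /eqP; rewrite mulf_eq0 => /orP[/eqP //|].
by rewrite (negbTE (bei_gen_neq0 _)) // (inj_eq t_inj) eq_sym.
Qed.

Theorem koszul_no_claw : ~ koszul (@bei_grading k m h).
Proof.
pose t0 := t ord0; pose t1 := t (lift ord0 ord0); pose t2 := t ord_max.
pose a : 'rV[S]_3 := \row_e
  if e == ord0 then f t1 t2 else if e == ord_max then f t0 t1 else - f t0 t2.
have t_neq e e' : e != e' -> t e != t e' by rewrite (inj_eq t_inj).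
have tE0 : t (lift ord0 (lift ord0 (ord0 : 'I_1))) = t2 by congr t; apply: val_inj.
move=> K; have : a = 0.
  apply: (@edge_obstruction Z 3 2 v phi 2 a) K => //.
  - move=> l l'; rewrite /v; case: eqP => [->|/eqP n0]; case: eqP => [->|/eqP n0'] // /eqP.
    + by rewrite eq_lrshift.
    + by rewrite eq_rlshift.
    by move=> _; apply/val_inj; move: n0 n0'; case: l l' => [[|[|//]] ?] [[|[|//]] ?].
  - by move=> l; rewrite /v; case: ifP; rewrite ?claw_Zx ?claw_Zy leaf_v0.
  - move=> e l; rewrite mxE; case: ifP => _; first exact: bei_y_homog.
    by rewrite dhomogN bei_x_homog.
  - apply/matrixP => e l; rewrite !mxE; case: ifP => _.
      by rewrite claw_y leaf_t.
    by rewrite rmorphN /= claw_x leaf_t.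
  - move=> e; exists v0, (t e); split; first exact: hv.
    by rewrite big_ord_recl big_ord1 !mxE /v /= /bei_gen /bei_x /bei_y; ring.
  - move=> i j hij; rewrite rmorphB !rmorphM /= !claw_x !claw_y.
    case: (boolP (leaf i)) => [/existsP[e /eqP te]|_]; last by rewrite mul0r mulr0 subrr.
    case: (boolP (leaf j)) => [/existsP[e' /eqP te']|_]; last by rewrite mul0r mulr0 subrr.
    by move: hij; rewrite -te -te' t_ind.
  - move=> i j hij.
    have half i' j' : h i' j' -> i' = v0 -> exists c : 'I_3 -> S, forall l,
        linear_part Z v l (f i' j') = \sum_e phi e l * c e.
      move=> hij' iv; have jv : j' == v0 = false.
        by apply/eqP => jv; move: hij'; rewrite iv jv h_irr.
      have [/existsP[e /eqP te]|nl] := boolP (leaf j').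
        exists (fun e' => (e' == e)%:R) => l; rewrite (bigD1 e) //= eqxx mulr1 big1; last first.
          by move=> e' /negbTE ->; rewrite mulr0.
        rewrite addr0 mxE /linear_part /v; case: ifP => _.
          by rewrite mderiv_bei_x iv eqxx jv mul1r mul0r subr0 claw_y -te leaf_t.
        by rewrite mderiv_bei_y iv eqxx jv mul1r mul0r sub0r rmorphN /= claw_x -te leaf_t.
      exists (fun=> 0) => l; rewrite big1 => [|e _]; last by rewrite mulr0.
      rewrite /linear_part /v; case: ifP => _.
        by rewrite mderiv_bei_x iv eqxx jv mul1r mul0r subr0 claw_y (negbTE nl).
      by rewrite mderiv_bei_y iv eqxx jv mul1r mul0r sub0r rmorphN /= claw_x (negbTE nl) oppr0.
    have [iv|niv] := eqVneq i v0; first exact: half.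
    have [jv|njv] := eqVneq j v0.
      have [|//|c cE] := half j i; first by rewrite h_sym.
      exists (fun e => - c e) => l; rewrite bei_gen_sym raddfN /= cE -sumrN.
      by apply: eq_bigr => e _; rewrite mulrN.
    exists (fun=> 0) => l; rewrite big1 => [|e _]; last by rewrite mulr0.
    rewrite /linear_part /v; case: ifP => _.
      by rewrite mderiv_bei_x (negbTE niv) (negbTE njv) !mul0r subrr rmorph0.
    by rewrite mderiv_bei_y (negbTE niv) (negbTE njv) !mul0r subrr rmorph0.
  - exact: claw_free.
  - move=> i e; rewrite mxE; do ?case: ifP => _; rewrite ?dhomogN;
      exact: bei_gen_homog.
  - apply/matrixP => i e; rewrite !mxE.
    have Zf e1 e2 : zeroing Z (f (t e1) (t e2)) = f (t e1) (t e2).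
      by rewrite rmorphB !rmorphM /= !claw_x !claw_y !leaf_t.
    by do ?case: ifP => _; rewrite ?rmorphN /= Zf.
  - apply/matrixP => i l; rewrite !mxE (eq_bigr (fun e => phi e l * a 0 e)) => [|e _].
      rewrite claw_sum !big_ord_recl !big_ord0 !mxE /= tE0 -/t0 -/t1 /bei_gen.
      by case: ifP => _; ring.
    by rewrite mulrC (ord1 i).
move/matrixP/(_ 0 ord0)/eqP; rewrite !mxE /= (negbTE (bei_gen_neq0 _)) //.
exact: t_neq.
Qed.

End Claw.


(** The linear variables are the [x (t l)], the coefficients are the polynomials in
    the [y (t l)]. Dividing the edge [f i j] by [y i * y j] gives
    [x i / y i - x j / y j], whose sum along the cycle vanishes: this is the syzygy
    [a], of degree [n - 2] once denominators are cleared. *)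
Section Cycle.

Variables (n : nat) (t : 'I_n -> 'I_m).
Hypotheses (n_gt3 : (3 < n)%N) (t_inj : injective t).
Hypothesis t_cycle : forall i j, h (t i) (t j) = (j == ordS i) || (i == ordS j).

Let Z (q : 'I_(m + m)) := match split q with
  inl j => true | inr j => ~~ [exists e, t e == j] end.

Lemma cycle_x j : zeroing Z (x j) = 0.
Proof. by rewrite zeroingX /Z (unsplitK (inl j)). Qed.
Lemma cycle_y e : zeroing Z (y (t e)) = y (t e).
Proof.
rewrite zeroingX /Z (unsplitK (inr (t e))); case: existsP => // -[].
by exists e.
Qed.
Lemma cycle_y0 j : ~~ [exists e, t e == j] -> zeroing Z (y j) = 0.
Proof. by rewrite zeroingX /Z (unsplitK (inr j)) => ->. Qed.

Lemma val_iter_ordS j (i : 'I_n) : val (iter j (@ordS n) i) = ((i + j) %% n)%N.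
Proof.
elim: j => [|j IH]; first by rewrite addn0 modn_small.
by rewrite iterS /= [nat_of_ord _]IH -addn1 modnDml addn1 addnS.
Qed.

Lemma ordS_neq (i : 'I_n) : ordS i != i.
Proof. by rewrite -val_eqE val_ordS; apply/eqP; case: eqP => /=; lia. Qed.

Lemma card_off_edge (e : 'I_n) :
  #|[pred j | (j != e) && (j != ordS e)]| = (n - 2)%N.
Proof.
have := cardC (pred2 e (ordS e)); rewrite card2 card_ord eq_sym ordS_neq => E.
apply/eqP; rewrite -(eqn_add2l 2) subnKC; last by lia.
rewrite -[X in _ == X]E; apply/eqP; congr (_ + _)%N.
by apply: eq_card => j; rewrite !inE negb_or.
Qed.

Let v (l : 'I_n) := lshift m (t l).
Let phi : 'M[S]_n :=
  \matrix_(e, l) ((l == e)%:R * y (t (ordS e)) - (l == ordS e)%:R * y (t e)).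

Lemma cycle_sum (c : 'I_n -> S) l :
  \sum_e phi e (ordS l) * c e = y (t (ordS (ordS l))) * c (ordS l) - y (t l) * c l.
Proof.
rewrite (bigD1 (ordS l)) //= (bigD1 l) /=; last by rewrite eq_sym ordS_neq.
rewrite !mxE eqxx (negbTE (ordS_neq l)) [ordS l == ordS _]eq_sym (negbTE (ordS_neq _)).
rewrite !mul1r !mul0r subr0 sub0r big1 ?addr0 ?mulNr // => e /andP[ne1 ne2].
rewrite mxE eq_sym (negbTE ne1) (inj_eq (@ordS_inj n)) eq_sym (negbTE ne2).
by rewrite !mul0r subrr mul0r.
Qed.

(** A syzygy [c] satisfies [c (ordS l) * y (t (ordS (ordS l))) = c l * y (t l)].
    Starting from [y (t u) = 0] and moving along the cycle, this kills [c e] for every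
    [e] but [u] and its predecessor. Hence [c e] is divisible by [n - 2]
    variables. *)
Lemma cycle_free (c : 'I_n -> S) d' : (d' < n - 2)%N -> (forall e, c e \is d'.-homog) ->
  (forall l, \sum_e phi e l * c e = 0) -> forall e, c e = 0.
Proof.
move=> d2 hc c0 e.
pose P : pred 'I_n := [pred j | (j != e) && (j != ordS e)].
apply: (@zeroing_eq0 _ _ _ P (fun u => pred1 (rshift m (t u))) d' (c e)) => //.
- by move=> u w i _ _ /eqP -> /eqP/esym/rshift_inj/t_inj.
- by rewrite card_off_edge.
move=> u Pu; set sg := zeroing _.
have sgy w : sg (y (t w)) = if w == u then 0 else y (t w).
  by rewrite /sg zeroingX /= eq_rshift (inj_eq t_inj).
have step l : ordS (ordS l) != u -> sg (y (t l) * c l) = 0 -> sg (c (ordS l)) = 0.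
  move=> ne yc; have /eqP := c0 (ordS l); rewrite cycle_sum subr_eq0.
  move=> /eqP/(congr1 sg); rewrite yc {1}/sg rmorphM /= -/sg sgy (negbTE ne) => /eqP.
  by rewrite mulf_eq0 (negbTE (mpolyX_neq0 _ _)) => /eqP.
have iter_neq j : (0 < j < n)%N -> iter j (@ordS n) u != u.
  move=> /andP[j0 jn]; rewrite -val_eqE val_iter_ordS /=; have un := ltn_ord u.
  have := divn_eq (u + j)%N n; case: ((u + j) %/ n)%N => [|[|q]]; apply: contra_eqN => /eqP ->; nia.
have kill j : (j < n - 2)%N -> sg (c (iter j.+1 (@ordS n) u)) = 0.
  elim: j => [|j IH] jn; apply: step; rewrite -?iterS.
  - by apply: (iter_neq 2%N); lia.
  - by rewrite /sg rmorphM /= -/sg sgy eqxx mul0r.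
  - by apply: (iter_neq j.+3); lia.
  - by rewrite /sg rmorphM /= -/sg IH ?mulr0 //; lia.
have [ue us] : u != e /\ u != ordS e.
  by apply/andP.
pose j := ((e + n - u) %% n)%N.
have eE : iter j (@ordS n) u = e.
  apply: val_inj; rewrite val_iter_ordS /j modnDmr.
  have -> : (u + (e + n - u) = e + n)%N by have := ltn_ord u; lia.
  by rewrite modnDr modn_small.
have jn : (j < n)%N by rewrite ltn_pmod; lia.
have j0 : j != 0%N by apply: contraNneq ue => j0; rewrite -eE j0.
have jn1 : j != n.-1.
  apply: contraNneq us => j1; rewrite -eE -iterS j1 prednK; last by lia.
  by apply/eqP/val_inj; rewrite val_iter_ordS modnDr modn_small.
have := kill j.-1; rewrite prednK ?eE; last by lia.
by apply; lia.
Qed.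

Theorem koszul_no_cycle : ~ koszul (@bei_grading k m h).
Proof.
pose a : 'rV[S]_n := \row_e \prod_(j | (j != e) && (j != ordS e)) y (t j).
have n0 : (0 < n)%N by lia.
move=> K; have : a = 0.
  apply: (@edge_obstruction Z n n v phi (n - 2) a) K => //.
  - by move=> l l' /lshift_inj/t_inj.
  - by move=> l; rewrite /Z /v (unsplitK (inl (t l))).
  - move=> e l; rewrite mxE; apply: rpredB; case: (_ == _);
      rewrite ?mul1r ?mul0r ?rpred0 // ?bei_y_homog //.
  - by apply/matrixP => e l; rewrite !mxE rmorphB !rmorphM /= !rmorph_nat !cycle_y.
  - move=> e; exists (t e), (t (ordS e)); split; first by rewrite t_cycle eqxx.
    rewrite (bigD1 e) //= (bigD1 (ordS e)) ?ordS_neq //= !mxE !eqxx.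
    rewrite (negbTE (ordS_neq e)) eq_sym (negbTE (ordS_neq e)) big1.
      by rewrite !mul1r !mul0r addr0 subr0 sub0r /v /bei_gen /bei_x; ring.
    move=> l /andP[/negbTE ne /negbTE ns].
    by rewrite mxE ne ns !mul0r subrr mul0r.
  - by move=> i j _; rewrite rmorphB !rmorphM /= !cycle_x !mul0r subrr.
  - move=> i j hij.
    have lpE l : linear_part Z v l (f i j) =
        (i == t l)%:R * zeroing Z (y j) - (j == t l)%:R * zeroing Z (y i).
      by rewrite /linear_part /v mderiv_bei_x rmorphB !rmorphM /= !rmorph_nat.
    have [/existsP[e /eqP ei]|ni] := boolP [exists e, t e == i]; last first.
      exists (fun=> 0) => l; rewrite lpE (cycle_y0 ni) mulr0 subr0 big1.
        case: eqP => [il|_]; last by rewrite mul0r.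
        by case/existsP: ni; exists l; rewrite il.
      by move=> e _; rewrite mulr0.
    have [/existsP[e' /eqP ej]|nj] := boolP [exists e, t e == j]; last first.
      exists (fun=> 0) => l; rewrite lpE (cycle_y0 nj) mulr0 sub0r big1.
        case: eqP => [jl|_]; last by rewrite mul0r oppr0.
        by case/existsP: nj; exists l; rewrite jl.
      by move=> e' _; rewrite mulr0.
    have delta (e1 : 'I_n) l : \sum_e phi e l * (e == e1)%:R = phi e1 l.
      rewrite (bigD1 e1) //= eqxx mulr1 big1 ?addr0 // => e2 /negbTE ->.
      by rewrite mulr0.
    have lpt e1 l : linear_part Z v l (f (t e1) (t (ordS e1))) = phi e1 l.
      rewrite /linear_part /v mderiv_bei_x rmorphB !rmorphM /= !rmorph_nat !cycle_y.
      by rewrite !(inj_eq t_inj) mxE ![_ == l]eq_sym.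
    move: hij; rewrite -ei -ej t_cycle => /orP[/eqP ->|/eqP ->].
      by exists (fun e1 => (e1 == e)%:R) => l; rewrite delta lpt.
    exists (fun e1 => - (e1 == e')%:R) => l; rewrite bei_gen_sym raddfN /= lpt -delta.
    by rewrite -sumrN; apply: eq_bigr => e1 _; rewrite mulrN.
  - exact: cycle_free.
  - by lia.
  - move=> i e; rewrite mxE.
    rewrite -(card_off_edge e).
    rewrite -sum1_card; apply: (big_ind2 (fun p d' => p \is d'.-homog)).
    + exact: dhomog1.
    + by move=> p1 d1 p2 d2; exact: dhomogM.
    + by move=> j _; exact: bei_y_homog.
  - apply/matrixP => i e; rewrite !mxE rmorph_prod /=.
    by apply: eq_bigr => j _; rewrite cycle_y.
  - apply/rowP => l; rewrite !mxE -[l](ord_predK (n := n)).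
    rewrite (eq_bigr (fun e => phi e (ordS (ord_pred l)) * a 0 e)) => [|e _]; last by rewrite mulrC.
    rewrite cycle_sum; set l' := ord_pred l; rewrite !mxE; apply/eqP; rewrite subr_eq0.
    have := ordS_neq l'; have := ordS_neq (ordS l') => n1 n2.
    apply/eqP; transitivity (\prod_(j | j != ordS l') y (t j)).
      by rewrite [RHS](bigD1 (ordS (ordS l'))).
    rewrite [LHS](bigD1 l') 1?eq_sym //=; congr (_ * _).
    by apply: eq_bigl => j; rewrite andbC.
move/rowP/(_ (Ordinal n0))/eqP; rewrite !mxE; apply/negP.
by apply/prodf_neq0 => j _; exact: mpolyX_neq0.
Qed.

End Cycle.

End EdgeIdealObstruction.

(** * The cone over a graph *)

Section Obstructions.

Variables (k : fieldType) (U : finType) (g : rel U).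
Hypotheses (g_sym : symmetric g) (g_irr : irreflexive g).

Let h : rel 'I_#|U| := fun i j => g (enum_val i) (enum_val j).

Lemma koszul_graph_no_claw v (t : 'I_3 -> U) : koszul_graph k g ->
  injective t -> (forall i, g v (t i)) -> (forall i j, g (t i) (t j) = false) -> False.
Proof.
move=> kosz t_inj gv t_ind.
apply: (@koszul_no_claw k _ h _ _ (enum_rank v) (enum_rank \o t)) kosz.
- by move=> i j; apply: g_sym.
- by move=> i; apply: g_irr.
- by move=> i j /enum_rank_inj/t_inj.
- by move=> i; rewrite /h /= !enum_rankK.
- by move=> i j; rewrite /h /= !enum_rankK.
Qed.

Lemma koszul_graph_chordal : koszul_graph k g -> chordal g.
Proof.
move=> kosz n n_gt3 [t [t_inj tE]].
apply: (@koszul_no_cycle k _ h n (enum_rank \o t) n_gt3) kosz.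
- by move=> i j /enum_rank_inj/t_inj.
- by move=> i j; rewrite /h /= !enum_rankK.
Qed.

End Obstructions.

Section Cones.

Variables (k : fieldType) (T : finType) (e : rel T).
Hypotheses (e_sym : symmetric e) (e_irr : irreflexive e).

Lemma cone_irr : irreflexive (cone e).
Proof. by case=> [x|] //=. Qed.

(** Three independent vertices of the graph are the leaves of a claw centred at the
    apex. *)
Lemma koszul_cone_triangle_free :
  koszul_graph k (cone e) -> triangle_free (independence_complex e).
Proof.
move=> kosz a b c ab ac bc; apply/negP; rewrite inE => /forall_inP ind.
have nadj x y : x \in [set a; b; c] -> y \in [set a; b; c] -> e x y = false.
  move=> xs ys; have [->|xy] := eqVneq x y; first exact: e_irr.
  by apply/negbTE; have /forall_inP/(_ y ys)/implyP := ind x xs; apply.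
pose s := [:: a; b; c]; pose t (i : 'I_3) := Some (nth a s i).
have ts (i : 'I_3) : nth a s i \in [set a; b; c].
  by case: i => [[|[|[|//]]]] /= _; rewrite !inE eqxx ?orbT.
apply: (@koszul_graph_no_claw k _ _ (cone_sym e_sym) cone_irr None t) => //.
- move=> i j [] /eqP; rewrite nth_uniq //= ?inE ?negb_or ?ab ?ac ?bc //.
  by move/eqP/val_inj.
- by move=> i j; apply: nadj.
Qed.

Lemma koszul_cone_chordal : koszul_graph k (cone e) -> chordal e.
Proof.
move=> /(koszul_graph_chordal) chC n n_gt3 [t [t_inj tE]].
apply: (chC n n_gt3); exists (Some \o t); split=> [i j [/t_inj]|] //.
Qed.

Lemma interval_labelling_koszul lab :
  interval_labelling (cone e) lab -> koszul_graph k (cone e).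
Proof.
case=> lab_bij lab_int.
apply: (@interval_koszul k _ _ _ (fun i => lab (enum_val i))).
- by move=> i j; apply: cone_sym.
- by move=> i j /val_inj/(bij_inj lab_bij)/enum_val_inj.
- by move=> a b c; apply: lab_int.
Qed.

End Cones.

Theorem proposition3p1 (k : fieldType) (k_char0 : [pchar k]%R =i pred0)
    (T : finType) (e : rel T) (e_sym : symmetric e) (e_irr : irreflexive e) :
  [<-> koszul_graph k (cone e);
       closed_graph (cone e);
       triangle_free (independence_complex e) /\ chordal e].
Proof.
tfae.
- move=> kosz.
  have [lab labP] := cone_interval_labelling e_sym e_irr
    (koszul_cone_chordal kosz) (koszul_cone_triangle_free e_sym e_irr kosz).
  exact: interval_closed (cone_sym e_sym) labP.
- move=> cl; split; first exact: closed_cone_triangle_free cl.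
  exact: closed_cone_chordal cl.
- move=> [tf ch]; have [lab labP] := cone_interval_labelling e_sym e_irr ch tf.
  exact: (interval_labelling_koszul k e_sym labP).
Qed.
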